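(* There is a polynomial-time $9$-approximation algorithm for Priority $k$-Center with Outliers.
   Context: Priority $k$-Center with Outliers: the input is a finite metric space $(X,d)$, a radius function $r:X\to\mathbb{R}_{>0}$, and integers $k,m$. The goal is to find $S\subseteq X$ with $|S|\le k$ minimizing $\alpha$ such that at least $m$ points $v\in X$ satisfy $d(v,S)\le \alpha\cdot r(v)$, where $d(v,S)=\min_{s\in S}d(v,s)$. A $\rho$-approximation algorithm outputs a feasible $S$ achieving value at most $\rho$ times the optimum value of $\alpha$. *)

(* Defs.v *)
From HB Require Import structures.
From mathcomp Require Import all_boot all_order all_algebra.
From mathcomp Require Import constructive_ereal.

Set Implicit Arguments.
Unset Strict Implicit.
Unset Printing Implicit Defensive.

Import Order.TTheory GRing.Theory Num.Theory.

Local Open Scope ring_scope.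

(* Points are numbered 0, ..., n-1.  Distances and radii are rational, as
   required for an instance to be the finite input of an algorithm.          *)
Record instance := Instance {
  npts : nat;
  dist : 'I_npts -> 'I_npts -> rat;
  radius : 'I_npts -> rat;
  cap : int;
  target : int;
  dist_eq0 : forall u v, dist u v = 0 <-> u = v;
  distC : forall u v, dist u v = dist v u;
  dist_triangle : forall u v w, dist u w <= dist u v + dist v w;
  radius_gt0 : forall v, 0 < radius v }.

(* d(v, S), with d(v, set0) = +oo. *)
Definition dist_set (I : instance) (v : 'I_(npts I)) (S : {set 'I_(npts I)})
    : \bar rat :=
  \big[Order.min/+oo%E]_(s in S) (dist v s)%:E.

Definition covered (I : instance) (S : {set 'I_(npts I)}) (a : rat) :=
  [set v | (dist_set v S <= (a * radius v)%:E)%E].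

Definition feasible (I : instance) (S : {set 'I_(npts I)}) : Prop :=
  #|S|%:Z <= cap I.

(* The dilation a is nonnegative by convention; this is automatic as soon as
   target I > 0.                                                             *)
Definition achieves (I : instance) (S : {set 'I_(npts I)}) (a : rat) : Prop :=
  0 <= a /\ target I <= #|covered S a|%:Z.

Definition is_optimum (I : instance) (a : rat) : Prop :=
  (exists2 S : {set 'I_(npts I)}, feasible S & achieves S a) /\
  (forall (S : {set 'I_(npts I)}) b, feasible S -> achieves S b -> a <= b).

Definition approx_solution (I : instance) (rho : rat) (S : {set 'I_(npts I)})
    : Prop :=
  feasible S /\
  forall opt, is_optimum I opt -> exists2 a, achieves S a & a <= rho * opt.

(* Model of computation: a random access machine over the integers, with
   structured control flow instead of jumps, a sequential input tape, a
   sequential output tape, and the logarithmic cost criterion (every operation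
   is charged the bit length of its operands, addresses included).           *)

Inductive expr :=
  | Const of int
  | Cell of expr
  | Plus of expr & expr
  | Minus of expr & expr
  | Times of expr & expr
  | Quot of expr & expr
  | Leq of expr & expr.

Inductive cmd :=
  | Skip
  | Store of expr & expr
  | Read of expr
  | Write of expr
  | Seq of cmd & cmd
  | If of expr & cmd & cmd
  | While of expr & cmd.

Definition memory := int -> int.

Definition update (M : memory) (i x : int) : memory :=
  fun j => if j == i then x else M j.

Record state := State { cells : memory; inp : seq int; out : seq int }.

Fixpoint eval (M : memory) (e : expr) : int :=
  match e with
  | Const z => z
  | Cell e1 => M (eval M e1)
  | Plus e1 e2 => eval M e1 + eval M e2
  | Minus e1 e2 => eval M e1 - eval M e2
  | Times e1 e2 => eval M e1 * eval M e2
  | Quot e1 e2 => (eval M e1 %/ eval M e2)%Z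
  | Leq e1 e2 => (eval M e1 <= eval M e2)%R%:Z
  end.

(* Number of binary digits, plus one for the sign. *)
Definition bitlen (z : int) : nat := (trunc_log 2 `|z|%N).+2.

Fixpoint expr_cost (M : memory) (e : expr) : nat :=
  match e with
  | Const z => bitlen z
  | Cell e1 => (expr_cost M e1 + bitlen (eval M e1) + bitlen (M (eval M e1)))%N
  | Plus e1 e2 | Minus e1 e2 | Times e1 e2 | Quot e1 e2 | Leq e1 e2 =>
      (expr_cost M e1 + expr_cost M e2 +
       bitlen (eval M e1) + bitlen (eval M e2))%N
  end.

(* exec c s s' t: started in state s, the command c halts in state s' after
   time t.  Reading past the end of the input yields 0.                      *)
Inductive exec : cmd -> state -> state -> nat -> Prop :=
  | ESkip s : exec Skip s s 1
  | EStore e1 e2 M i o :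
      exec (Store e1 e2) (State M i o)
        (State (update M (eval M e1) (eval M e2)) i o)
        (expr_cost M e1 + expr_cost M e2 +
         bitlen (eval M e1) + bitlen (eval M e2))%N
  | ERead e M i o :
      exec (Read e) (State M i o)
        (State (update M (eval M e) (head 0 i)) (behead i) o)
        (expr_cost M e + bitlen (eval M e) + bitlen (head 0%R i))%N
  | EWrite e M i o :
      exec (Write e) (State M i o) (State M i (rcons o (eval M e)))
        (expr_cost M e + bitlen (eval M e))%N
  | ESeq c1 c2 s1 s2 s3 t1 t2 :
      exec c1 s1 s2 t1 -> exec c2 s2 s3 t2 ->
      exec (Seq c1 c2) s1 s3 (t1 + t2)%N
  | EIfT e c1 c2 s s' t :
      eval (cells s) e != 0 -> exec c1 s s' t ->
      exec (If e c1 c2) s s' (expr_cost (cells s) e + t)%N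
  | EIfF e c1 c2 s s' t :
      eval (cells s) e = 0 -> exec c2 s s' t ->
      exec (If e c1 c2) s s' (expr_cost (cells s) e + t)%N
  | EWhileT e c s1 s2 s3 t1 t2 :
      eval (cells s1) e != 0 -> exec c s1 s2 t1 -> exec (While e c) s2 s3 t2 ->
      exec (While e c) s1 s3 (expr_cost (cells s1) e + t1 + t2)%N
  | EWhileF e c s :
      eval (cells s) e = 0 -> exec (While e c) s s (expr_cost (cells s) e).

Definition encode_rat (q : rat) : seq int := [:: numq q; denq q].

(* The input tape: n, k, m, the n radii, the n x n distance matrix by rows. *)
Definition encode (I : instance) : seq int :=
  [:: (npts I)%:Z; cap I; target I] ++
  flatten [seq encode_rat (radius v) | v <- enum 'I_(npts I)] ++
  flatten [seq encode_rat (dist u v) | u <- enum 'I_(npts I),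
                                       v <- enum 'I_(npts I)].

Definition input_size (I : instance) : nat :=
  (\sum_(z <- encode I) bitlen z)%N.

Definition start (I : instance) : state := State (fun=> 0) (encode I) [::].

(* The output tape lists the (indices of the) chosen points, in any order. *)
Definition outputs (I : instance) (s : state) (S : {set 'I_(npts I)}) : Prop :=
  exists2 l : seq 'I_(npts I),
    out s = [seq (val v)%:Z | v <- l] & S = [set v in l].

Definition polynomial_time (A : cmd) : Prop :=
  exists p : {poly nat}, forall I : instance,
  exists s t, exec A (start I) s t /\ (t <= p.[input_size I])%N.

(* If the budget and the coverage requirement cannot both be met, there is no
   optimum and the output is unconstrained.                                  *)
Definition approximates (A : cmd) (rho : rat) : Prop :=
  forall (I : instance) s t, exec A (start I) s t ->
  forall opt, is_optimum I opt ->
  exists2 S : {set 'I_(npts I)}, outputs s S & approx_solution rho S.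

Lemma exec_det c s s1 t1 s2 t2 :
  exec c s s1 t1 -> exec c s s2 t2 -> s1 = s2 /\ t1 = t2.
Proof.
move=> E1; elim: E1 s2 t2 => {c s s1 t1}.
- by move=> s s2 t2 E; inversion E.
- by move=> e1 e2 M i o s2 t2 E; inversion E.
- by move=> e M i o s2 t2 E; inversion E.
- by move=> e M i o s2 t2 E; inversion E.
- move=> c1 c2 s1 s2 s3 t1 t2 _ IH1 _ IH2 s t E; inversion E; subst.
  match goal with H : exec c1 _ _ _ |- _ => case: (IH1 _ _ H) => ? ? end; subst.
  by match goal with H : exec c2 _ _ _ |- _ => case: (IH2 _ _ H) => ? ? end; subst.
- move=> e c1 c2 s s' t /eqP ne _ IH s2 t2 E; inversion E; subst => //.
  by match goal with H : exec c1 _ _ _ |- _ => case: (IH _ _ H) => -> -> end.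
- move=> e c1 c2 s s' t e0 _ IH s2 t2 E; inversion E; subst.
    by match goal with H : is_true (_ != 0) |- _ => rewrite e0 eqxx in H end.
  by match goal with H : exec c2 _ _ _ |- _ => case: (IH _ _ H) => -> -> end.
- move=> e c s1 s2 s3 t1 t2 /eqP ne _ IH1 _ IH2 s t E; inversion E; subst => //.
  match goal with H : exec c _ _ _ |- _ => case: (IH1 _ _ H) => ? ? end; subst.
  by match goal with H : exec (While _ _) _ _ _ |- _ =>
    case: (IH2 _ _ H) => ? ? end; subst.
- move=> e c s e0 s2 t2 E; inversion E; subst => //.
  by match goal with H : is_true (_ != 0) |- _ => rewrite e0 eqxx in H end.
Qed.

Lemma dist_setP (I : instance) (v : 'I_(npts I)) (S : {set 'I_(npts I)}) a :
  reflect (exists2 s, s \in S & dist v s <= a) (dist_set v S <= a%:E)%E.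
Proof.
rewrite /dist_set; apply: (iffP idP) => [|[s sS le_sa]].
  elim/big_rec: _ => [|s x sS IH]; first by rewrite leNgt ltry.
  rewrite ge_min => /orP[|/IH//]; rewrite lee_fin => ?; by exists s.
by rewrite (bigD1 s) //= ge_min lee_fin le_sa.
Qed.

Lemma achieves_le (I : instance) (S : {set 'I_(npts I)}) a b :
  a <= b -> achieves S a -> achieves S b.
Proof.
move=> ab [a0 cov]; split; first exact: le_trans ab.
apply: le_trans cov _; rewrite lez_nat; apply: subset_leq_card.
apply/subsetP => v; rewrite !inE => /le_trans; apply.
by rewrite lee_fin ler_wpM2r // ltW // radius_gt0.
Qed.

(* An optimum exists as soon as some feasible set achieves some value: only
   the values 0 and d(v, s) / r(v) are relevant.                             *)
Lemma optimum_exists (I : instance) (S : {set 'I_(npts I)}) a :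
  feasible S -> achieves S a -> exists opt, is_optimum I opt.
Proof.
move=> fS aS.
pose T := option ('I_(npts I) * 'I_(npts I)).
pose val (x : T) := if x is Some (v, s) then dist v s / radius v else 0 : rat.
pose good (x : T) := [exists S' : {set 'I_(npts I)},
  (#|S'|%:Z <= cap I) && ((0 <= val x) &&
   (target I <= #|covered S' (val x)|%:Z))].
have low (S' : {set 'I_(npts I)}) b : feasible S' -> achieves S' b -> exists2 x, good x & val x <= b.
  move=> fS' [b0 cov].
  pose c (x : T) := (0 <= val x) && (val x <= b).
  have cN : c None by rewrite /c lexx.
  case: (arg_maxP val cN) => x /andP[x0 xb] xmax.
  exists x => //; apply/existsP; exists S'; rewrite fS' x0 /=.
  apply: le_trans cov _; rewrite lez_nat; apply: subset_leq_card.
  apply/subsetP => v; rewrite !inE => /dist_setP[s sS' ds].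
  apply/dist_setP; exists s => //; rewrite -ler_pdivrMr ?radius_gt0 //.
  have [neg|pos] := ltP (dist v s / radius v) 0; first exact: le_trans (ltW neg) x0.
  apply: (xmax (Some (v, s))); rewrite /c /= pos.
  by rewrite ler_pdivrMr ?radius_gt0.
have [x0 gx0 _] := low _ _ fS aS.
case: (arg_minP val gx0) => x gx xmin.
exists (val x); split.
  by case/existsP: gx => S' /andP[fS' /andP[? ?]]; exists S'.
by move=> S' b fS' /(low _ _ fS')[y gy]; apply: le_trans (xmin y gy).
Qed.

(* Main.v *)
(** Fix a dilation a = d(v0, s0) / r(v0); only such values matter, and the
    smallest one that succeeds is kept.  Given integer scores c on the points,
    repeatedly let an uncaptured point p of maximal score capture all
    uncaptured points v with r(p) <= 2 r(v) and d(p, v) <= a (r(p) + r(v)), and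
    let w(p) be the number of points captured by p.  Then
    sum_v c(v) <= sum_p w(p) c(p), and the capturing points covered by one and
    the same center have radii decreasing by factors larger than 2, hence form
    a path in the graph of the pairs (u, v) with d(u, v) <= a (r(u) + r(v)) and
    r(u) > 2 r(v).  A maximum weight family of k such paths is a maximum weight
    permutation, which an auction finds.  If it captures the required number
    of points, the ends of its paths are good centers: a path from p ends at
    distance at most 3 a r(p), so a point v captured by p is at distance at
    most a (r(v) + 4 r(p)) <= 9 a r(v).

    Otherwise let C be the unknown set of points that some k centers cover at
    dilation a.  The weights of C sum up to less than |C|, while
    sum_v (1 - w(v)) c(v) <= 0: this is a perceptron step.  After adding 1 - w
    to c, the square norm of c has grown by at most n^2 and its sum over C by
    at least 1, so by Cauchy-Schwarz there are at most n^3 failures.  This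
    replaces the linear programming relaxation.

    The algorithm is written in a language of bounded loops over arrays, which
    is compiled to the random access machine.  Stores only add, so that the
    numbers grow by a constant number of bits per step and the running time is
    polynomial by the structure of the program alone. *)
Require Import Defs.
From mathcomp Require Import all_boot all_order all_algebra.
From mathcomp Require Import perm zify ring lra.

Set Implicit Arguments.
Unset Strict Implicit.
Unset Printing Implicit Defensive.

Import Order.TTheory GRing.Theory Num.Theory.

Local Open Scope ring_scope.

(** * A language of bounded loops over integer arrays *)

Inductive hexpr :=
  | HC of int
  | HG of nat & hexpr
  | HP of hexpr & hexpr
  | HM of hexpr & hexpr
  | HT of hexpr & hexpr
  | HL of hexpr & hexpr.

Inductive prog :=
  | PSkip
  | PPut of nat & hexpr & hexpr
  | PIn of nat & hexpr
  | POut of hexpr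
  | PSeq of prog & prog
  | PIf of hexpr & prog & prog
  | PFor of nat & nat & prog.

Definition arrays := nat -> int -> int.

Record hst := HSt { ar : arrays; hin : seq int; hout : seq int }.

Definition upd (f : arrays) a i x : arrays :=
  fun b j => if (b == a) && (j == i) then x else f b j.

Definition setx h a i x := HSt (upd (ar h) a i x) (hin h) (hout h).

Fixpoint heval (f : arrays) (e : hexpr) : int :=
  match e with
  | HC z => z
  | HG a e => f a (heval f e)
  | HP e1 e2 => heval f e1 + heval f e2
  | HM e1 e2 => heval f e1 - heval f e2
  | HT e1 e2 => heval f e1 * heval f e2
  | HL e1 e2 => (heval f e1 <= heval f e2)%R%:Z
  end.

(** A negative loop bound means no iteration, in agreement with the compiled loop, whose test then
    fails at once. *)
Definition natof (z : int) : nat := if z is Posz k then k else 0%N.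

Fixpoint run (p : prog) (h : hst) : hst :=
  match p with
  | PSkip => h
  | PPut a i e => setx h a (heval (ar h) i) (heval (ar h) e)
  | PIn a i => HSt (upd (ar h) a (heval (ar h) i) (head 0 (hin h)))
                 (behead (hin h)) (hout h)
  | POut e => HSt (ar h) (hin h) (rcons (hout h) (heval (ar h) e))
  | PSeq p q => run q (run p h)
  | PIf e p q => if heval (ar h) e != 0 then run p h else run q h
  | PFor x b p =>
      iter (natof (ar h b 0))
        (fun h => let h1 := run p h in setx h1 x 0 (ar h1 x 0 + 1))
        (setx h x 0 0)
  end.

Fixpoint writes (p : prog) : seq nat :=
  match p with
  | PPut a _ _ | PIn a _ => [:: a]
  | PSeq p q | PIf _ p q => writes p ++ writes q
  | PFor x _ p => x :: writes p
  | _ => [::]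
  end.

Fixpoint silent (p : prog) : bool :=
  match p with
  | PIn _ _ | POut _ => false
  | PSeq p q | PIf _ p q => silent p && silent q
  | PFor _ _ p => silent p
  | _ => true
  end.

Lemma run_frame p a h j : a \notin writes p -> ar (run p h) a j = ar h a j.
Proof.
elim: p h => [|b i e|b i|e|p IHp q IHq|e p IHp q IHq|x b p IHp] h //=.
- by rewrite inE /upd => /negPf ->.
- by rewrite inE /upd => /negPf ->.
- by rewrite mem_cat negb_or => /andP[/IHp Hp /IHq Hq]; rewrite Hq Hp.
- rewrite mem_cat negb_or => /andP[/IHp Hp /IHq Hq].
  by case: ifP => _; rewrite ?Hq ?Hp.
rewrite inE negb_or => /andP[/negPf ax /IHp Hp].
elim: (natof _) => [|k IH] /=; first by rewrite /upd ax.
by rewrite {1}/upd ax /= Hp.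
Qed.

Lemma run_silent p h :
  silent p -> hin (run p h) = hin h /\ hout (run p h) = hout h.
Proof.
elim: p h => [|b i e|b i|e|p IHp q IHq|e p IHp q IHq|x b p IHp] h //=.
- by case/andP => Hp Hq; have [<- <-] := IHp h Hp; apply: IHq.
- by case/andP => Hp Hq; case: ifP => _; [apply: IHp | apply: IHq].
move=> Hp; have {}IHp h' := IHp h' Hp;
  by elim: (natof _) => [|k [IH1 IH2]] //=; rewrite !(IHp _).1 !(IHp _).2.
Qed.

(** * Compilation to the random access machine *)

(* Interleaved, the arrays are unbounded in both directions and never overlap. *)
Definition stride : nat := 64.

Definition addr (a : nat) (i : int) : int := stride%:Z * i + a%:Z.

Fixpoint cex (e : hexpr) : expr :=
  match e with
  | HC z => Const z
  | HG a e => Cell (Plus (Times (Const stride%:Z) (cex e)) (Const a%:Z))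
  | HP e1 e2 => Plus (cex e1) (cex e2)
  | HM e1 e2 => Minus (cex e1) (cex e2)
  | HT e1 e2 => Times (cex e1) (cex e2)
  | HL e1 e2 => Leq (cex e1) (cex e2)
  end.

Definition caddr (a : nat) (e : hexpr) : expr :=
  Plus (Times (Const stride%:Z) (cex e)) (Const a%:Z).

Definition scal (x : nat) := HG x (HC 0).

Fixpoint comp (p : prog) : cmd :=
  match p with
  | PSkip => Skip
  | PPut a i e => Store (caddr a i) (cex e)
  | PIn a i => Read (caddr a i)
  | POut e => Write (cex e)
  | PSeq p q => Seq (comp p) (comp q)
  | PIf e p q => If (cex e) (comp p) (comp q)
  | PFor x b p =>
      Seq (Store (caddr x (HC 0)) (cex (HC 0)))
        (While (cex (HL (HP (scal x) (HC 1)) (scal b)))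
           (Seq (comp p) (Store (caddr x (HC 0)) (cex (HP (scal x) (HC 1))))))
  end.

Fixpoint ewf (e : hexpr) : bool :=
  match e with
  | HC _ => true
  | HG a e => (a < stride)%N && ewf e
  | HP e1 e2 | HM e1 e2 | HT e1 e2 | HL e1 e2 => ewf e1 && ewf e2
  end.

(* Stored expressions may not multiply: every store then lengthens the numbers
   in memory by a constant number of bits only. *)
Fixpoint additive (e : hexpr) : bool :=
  match e with
  | HC _ | HG _ _ | HL _ _ => true
  | HP e1 e2 | HM e1 e2 => additive e1 && additive e2
  | HT _ _ => false
  end.

(** The arrays in [prot] hold the loop bounds. Since no command writes to them, the compiled loop
    may read its bound again before each iteration, and a bound on these arrays at the start limits
    every loop of the run. With [prot] empty, no loop is allowed at all. *)
Fixpoint wf (prot : seq nat) (p : prog) : bool :=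
  match p with
  | PSkip => true
  | PPut a i e => [&& (a < stride)%N, a \notin prot, ewf i, ewf e & additive e]
  | PIn a i => [&& (a < stride)%N, a \notin prot & ewf i]
  | POut e => ewf e
  | PSeq p q => wf prot p && wf prot q
  | PIf e p q => [&& ewf e, wf prot p & wf prot q]
  | PFor x b p => [&& (x < stride)%N, (b < stride)%N, b \in prot, x \notin prot,
                      x \notin writes p & wf prot p]
  end.

Lemma wf_writes prot p a : wf prot p -> a \in prot -> a \notin writes p.
Proof.
move=> Hp ap; elim: p Hp => [|b i e|b i|e|p IHp q IHq|e p IHp q IHq|x b p IHp] //=.
- case/and5P => _ bp _ _ _; rewrite inE; by apply: contra bp => /eqP <-.
- case/and3P => _ bp _; rewrite inE; by apply: contra bp => /eqP <-.
- by case/andP => /IHp Hp /IHq Hq; rewrite mem_cat negb_or Hp.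
- by case/and3P => _ /IHp Hp /IHq Hq; rewrite mem_cat negb_or Hp.
case/and5P => _ _ _ xp /andP[_ /IHp Hp]; rewrite inE negb_or Hp andbT.
by apply: contra xp => /eqP <-.
Qed.

(** * Simulation of the arrays in memory, bit lengths and costs *)

Definition models (M : memory) (f : arrays) :=
  forall a i, (a < stride)%N -> M (addr a i) = f a i.

Definition bits (b : nat) (z : int) := (`|z| < 2 ^ b)%N.

(** Uniqueness of quotient and remainder in the division by [stride]. *)
Lemma addr_inj a b i j : (a < stride)%N -> (b < stride)%N ->
  (addr a i == addr b j) = (a == b) && (i == j).
Proof.
rewrite /addr /stride => Ha Hb; apply/eqP/andP; last by case=> /eqP-> /eqP->.
by move=> H; split; apply/eqP; lia.
Qed.

Lemma models_upd M f a i x : (a < stride)%N ->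
  models M f -> models (update M (addr a i) x) (upd f a i x).
Proof.
by move=> Ha HM b j Hb; rewrite /update /upd addr_inj // HM.
Qed.

Lemma bits_le b c z : (b <= c)%N -> bits b z -> bits c z.
Proof. by move=> bc H; apply: leq_trans H _; rewrite leq_exp2l. Qed.

Lemma bits_bitlen z : bits (bitlen z) z.
Proof.
rewrite /bits /bitlen; apply: leq_trans (@trunc_log_ltn 2 _ _) _ => //.
by rewrite leq_exp2l.
Qed.

Lemma bitlen_bits b z : bits b z -> (bitlen z <= b.+2)%N.
Proof.
rewrite /bits /bitlen => H; rewrite !ltnS; case: (posnP `|z|%N) => [->|z0].
  by rewrite trunc_log0.
by rewrite -(@leq_exp2l 2) //; apply: leq_trans (trunc_logP _ z0) (ltnW H).
Qed.

Lemma bitsD b c x y : bits b x -> bits c y -> bits (b + c).+1 (x + y).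
Proof.
rewrite /bits expnS expnD => Hx Hy.
have Px : (0 < 2 ^ b)%N by rewrite expn_gt0.
have Py : (0 < 2 ^ c)%N by rewrite expn_gt0.
by move: (2 ^ b)%N (2 ^ c)%N Hx Hy Px Py => p q; nia.
Qed.

Lemma bitsN b x : bits b (- x) = bits b x.
Proof. by rewrite /bits abszN. Qed.

Lemma bitsM b c x y : bits b x -> bits c y -> bits (b + c) (x * y).
Proof.
rewrite /bits expnD abszM => Hx Hy; apply: ltn_mul; by [].
Qed.

Lemma bits_bool b (t : bool) : bits b.+1 t%:Z.
Proof. by rewrite /bits expnS; have : (0 < 2 ^ b)%N := expn_gt0 2 b;
  case: t => /=; lia. Qed.

Lemma bits_nat b k : (k <= b)%N -> bits b k%:Z.
Proof. by move=> kb; apply: leq_ltn_trans kb (ltn_expl _ _). Qed.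

(** Size of the value of [e] in a memory whose cells have at most [b] bits. For a fixed expression
    this bound, like the cost bound [ecost], is linear in [b]. *)
Fixpoint ebits (e : expr) (b : nat) : nat :=
  match e with
  | Const z => bitlen z
  | Cell _ => b
  | Plus e1 e2 | Minus e1 e2 | Times e1 e2 | Quot e1 e2 | Leq e1 e2 =>
      (ebits e1 b + ebits e2 b).+1
  end.

Fixpoint ecost (e : expr) (b : nat) : nat :=
  match e with
  | Const z => bitlen z
  | Cell e1 => (ecost e1 b + (ebits e1 b).+2 + b.+2)%N
  | Plus e1 e2 | Minus e1 e2 | Times e1 e2 | Quot e1 e2 | Leq e1 e2 =>
      (ecost e1 b + ecost e2 b + (ebits e1 b).+2 + (ebits e2 b).+2)%N
  end.

Fixpoint noquot (e : expr) : bool :=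
  match e with
  | Const _ => true
  | Cell e => noquot e
  | Quot _ _ => false
  | Plus e1 e2 | Minus e1 e2 | Times e1 e2 | Leq e1 e2 => noquot e1 && noquot e2
  end.

Lemma noquot_cex e : noquot (cex e).
Proof. by elim: e => //= [a e ->|e1 -> e2 ->|e1 -> e2 ->|e1 -> e2 ->|e1 -> e2
  ->]. Qed.

Lemma eval_bits M b e : (forall j, bits b (M j)) -> noquot e ->
  bits (ebits e b) (eval M e).
Proof.
move=> HM; elim: e => //= [z _|e1 IH1 e2 IH2|e1 IH1 e2 IH2|e1 IH1 e2 IH2|e1 IH1
  e2 IH2].
- exact: bits_bitlen.
- by case/andP => /IH1 ? /IH2 ?; apply: bitsD.
- by case/andP => /IH1 ? /IH2 ?; apply: bitsD; rewrite ?bitsN.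
- by case/andP => /IH1 H1 /IH2 H2; apply: bits_le (bitsM H1 H2).
- by move=> _; apply: bits_bool.
Qed.

Lemma expr_cost_le M b e : (forall j, bits b (M j)) -> noquot e ->
  (expr_cost M e <= ecost e b)%N.
Proof.
move=> HM; elim: e => //= [e IH q|e1 IH1 e2 IH2|e1 IH1 e2 IH2|e1 IH1 e2 IH2|e1
  IH1 e2 IH2].
- rewrite !leq_add ?IH ?bitlen_bits //; exact: eval_bits.
- all: case/andP => q1 q2; rewrite !leq_add ?IH1 ?IH2 ?bitlen_bits //;
  exact: eval_bits.
Qed.

Lemma eval_cex M f e : models M f -> ewf e -> eval M (cex e) = heval f e.
Proof.
move=> HM; elim: e => //= [a e IH|e1 IH1 e2 IH2|e1 IH1 e2 IH2|e1 IH1 e2 IH2|e1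
  IH1 e2 IH2].
- by case/andP => Ha /IH ->; rewrite -[_ + _]/(addr a _) HM.
- all: by case/andP => /IH1 -> /IH2 ->.
Qed.

Fixpoint egrow (e : hexpr) : nat :=
  match e with
  | HC z => bitlen z
  | HP e1 e2 | HM e1 e2 => (egrow e1 + egrow e2).+1
  | _ => 1
  end.

(** A sum of numbers of [b + g] and [b + h] bits has at most [b + g + h + 1] bits: [b] enters only
    once. The cruder bound [bitsD] would double [b] at each store, which becomes exponential in a
    loop. *)
Lemma heval_grow M f b e : (forall j, bits b (M j)) -> models M f -> ewf e ->
  additive e -> bits (b + egrow e) (heval f e).
Proof.
move=> Hb HM; elim: e => //= [z _ _|a e _|e1 IH1 e2 IH2|e1 IH1 e2 IH2|e1 _ e2 _ _ _].
- by apply: bits_le (bits_bitlen z); rewrite leq_addl.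
- by case/andP => Ha _ _; rewrite -HM //; apply: bits_le (Hb _); rewrite leq_addr.
- case/andP => /IH1 H1 /IH2 H2 /andP[/H1 {}H1 /H2 {}H2].
  move: H1 H2; rewrite /bits addnS expnS !expnD.
  move: (2 ^ b)%N (2 ^ egrow e1)%N (2 ^ egrow e2)%N (expn_gt0 2 (egrow e1))
    (expn_gt0 2 (egrow e2)).
  by move=> u v w; nia.
- case/andP => /IH1 H1 /IH2 H2 /andP[/H1 {}H1 /H2 {}H2].
  move: H1 H2; rewrite /bits addnS expnS !expnD.
  move: (2 ^ b)%N (2 ^ egrow e1)%N (2 ^ egrow e2)%N (expn_gt0 2 (egrow e1))
    (expn_gt0 2 (egrow e2)).
  by move=> u v w; nia.
- by rewrite addn1; apply: bits_bool.
Qed.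

(* Bits added to the memory by p when every loop runs at most K times. *)
Fixpoint grow (p : prog) (K : nat) : nat :=
  match p with
  | PPut _ _ e => egrow e
  | PSeq p q | PIf _ p q => (grow p K + grow q K)%N
  | PFor _ _ p => (K * grow p K)%N
  | _ => 0%N
  end.

Definition scost (c : expr * expr) (b : nat) : nat :=
  (ecost c.1 b + ecost c.2 b + (ebits c.1 b).+2 + (ebits c.2 b).+2)%N.

Definition rcost (e : expr) (b : nat) : nat :=
  (ecost e b + (ebits e b).+2 + b.+2)%N.

Definition for_test x b := cex (HL (HP (scal x) (HC 1)) (scal b)).
Definition for_incr x := (caddr x (HC 0), cex (HP (scal x) (HC 1))).
Definition for_init x := (caddr x (HC 0), cex (HC 0)).

(* Time of p when every loop runs at most K times and all numbers stay below
   2 ^ b. *)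
Fixpoint time (p : prog) (K b : nat) : nat :=
  match p with
  | PSkip => 1%N
  | PPut a i e => scost (caddr a i, cex e) b
  | PIn a i => rcost (caddr a i) b
  | POut e => (ecost (cex e) b + (ebits (cex e) b).+2)%N
  | PSeq p q => (time p K b + time q K b)%N
  | PIf e p q => (ecost (cex e) b + (time p K b + time q K b))%N
  | PFor x bd p =>
      (scost (for_init x) b +
       (K * (ecost (for_test x bd) b + (time p K b + scost (for_incr x) b)) +
        ecost (for_test x bd) b))%N
  end.

Lemma scostP M b e1 e2 : (forall j, bits b (M j)) -> noquot e1 -> noquot e2 ->
  (expr_cost M e1 + expr_cost M e2 + bitlen (eval M e1) + bitlen (eval M e2)
   <= scost (e1, e2) b)%N.
Proof.
move=> Hb q1 q2.
by rewrite /scost !leq_add ?expr_cost_le ?bitlen_bits //; apply: eval_bits.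
Qed.

Lemma noquot_caddr a e : noquot (caddr a e).
Proof. by rewrite /= noquot_cex. Qed.

(** The size bound includes the unread input, since [PIn] copies it into memory. *)
Definition represents (b : nat) (s : state) (h : hst) :=
  [/\ models (cells s) (ar h), inp s = hin h, out s = hout h,
      (forall j, bits b (cells s j)) & (forall z, z \in inp s -> bits b z)].

Lemma represents_le b c s h : (b <= c)%N -> represents b s h -> represents c s h.
Proof.
move=> bc [? ? ? H1 H2]; split=> // [j|z zi]; apply: bits_le bc _;
  [exact: H1|exact: H2].
Qed.

Lemma represents_put b b' s h a i e : (a < stride)%N -> ewf i -> ewf e ->
  bits b' (heval (ar h) e) -> (b <= b')%N -> represents b s h ->
  exists s' t, [/\ exec (Store (caddr a i) (cex e)) s s' t,
    represents b' s' (setx h a (heval (ar h) i) (heval (ar h) e)) &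
    forall c, (b <= c)%N -> (t <= scost (caddr a i, cex e) c)%N].
Proof.
case: s => M inp out Ha wi we He bb' [/= HM Hi Ho Hb Hin].
set s' := (State (update M (eval M (caddr a i)) (eval M (cex e))) inp out).
have E := EStore (caddr a i) (cex e) M inp out.
exists s'; eexists; split; first exact: E.
- split=> //=.
  + rewrite (eval_cex HM we) (eval_cex HM wi) -/(addr a (heval (ar h) i)).
    exact: models_upd.
  + move=> j; rewrite /update; case: ifP => _; last exact: bits_le (Hb j).
    by rewrite (eval_cex HM we).
  + move=> z /Hin; exact: bits_le.
move=> c bc; apply: scostP; rewrite ?noquot_caddr ?noquot_cex // => j.
exact: bits_le (Hb j).
Qed.

(** Two size bounds are kept: [b] holds at the start and increases by [grow], whereas [bm] is fixed
    for the whole run, so that the times of successive commands are expressed in the same bound and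
    add up. The hypothesis [K <= b] makes room for the loop counters. *)
Lemma comp_run prot p K b bm s h :
  wf prot p -> (K <= b)%N -> (forall x, x \in prot -> ar h x 0 <= K%:Z) ->
  (b + grow p K <= bm)%N -> represents b s h ->
  exists s' t, [/\ exec (comp p) s s' t, represents (b + grow p K) s' (run p h) &
    (t <= time p K bm)%N].
Proof.
elim: p b s h => [|a i e|a i|e|p IHp q IHq|e p IHp q IHq|x bd p IHp] b s h.
- move=> _ _ _ _ Hr; exists s, 1%N; split=> //=; first exact: ESkip.
  by rewrite addn0.
- case/and5P => Ha _ wi we ae Kb _ bm_ge Hr.
  have [HM _ _ Hb _] := Hr.
  have [s' [t [E Hr' Ht]]] := represents_put Ha wi we (heval_grow Hb HM we ae)
    (leq_addr _ _) Hr.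
  exists s', t; split=> //; apply: Ht; apply: leq_trans bm_ge; exact: leq_addr.
- case/and3P => Ha _ wi Kb _ bm_ge; rewrite /= addn0 in bm_ge *.
  case: s => M inp out [/= HM Hi Ho Hb Hin].
  have Hb' j : bits bm (M j) by apply: bits_le (Hb j).
  have Hh : bits b (head 0 inp).
    by case: (inp) Hin => [|z l] H /=;
      [rewrite /bits absz0 expn_gt0 | apply: H; rewrite inE eqxx].
  do 2!eexists; split; first exact: ERead.
    split=> //=.
    + rewrite (eval_cex HM wi) -/(addr a (heval (ar h) i)) -Hi; exact: models_upd.
    + by rewrite Hi.
    + by move=> j; rewrite /update; case: ifP.
    + by move=> z zi; apply: Hin; apply: mem_behead.
  have q := noquot_caddr a i; rewrite -/(caddr a i).
  move: (caddr a i) q => e q; rewrite /rcost !leq_add ?expr_cost_le ?bitlen_bits //.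
    by apply: eval_bits.
  by apply: bits_le Hh.
- move=> /= we Kb _ bm_ge; rewrite addn0 in bm_ge *.
  case: s => M inp out [/= HM Hi Ho Hb Hin].
  have Hb' j : bits bm (M j) by apply: bits_le (Hb j).
  do 2!eexists; split; first exact: EWrite.
    by split=> //=; rewrite (eval_cex HM we) Ho.
  rewrite leq_add ?bitlen_bits ?expr_cost_le ?noquot_cex //.
  by apply: eval_bits => //; apply: noquot_cex.
- case/andP => wp wq Kb HK /= bm_ge Hr.
  have [|s1 [t1 [E1 R1 T1]]] := IHp b s h wp Kb HK _ Hr; first lia.
  have [| | |s2 [t2 [E2 R2 T2]]] := IHq (b + grow p K)%N s1 (run p h) wq _ _ _ R1.
  + lia.
  + by move=> y yp; rewrite run_frame ?HK // (wf_writes wp).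
  + lia.
  exists s2, (t1 + t2)%N; split;
    [exact: ESeq E1 E2 | by rewrite addnA | exact: leq_add].
- case/and3P => we wp wq Kb HK /= bm_ge Hr.
  have [HM _ _ Hb _] := Hr.
  have Hc : (expr_cost (cells s) (cex e) <= ecost (cex e) bm)%N.
    apply: expr_cost_le (noquot_cex e) => j; apply: bits_le (Hb j); lia.
  case: ifP => [ne|/negbFE/eqP e0].
    have [|s1 [t1 [E1 R1 T1]]] := IHp b s h wp Kb HK _ Hr; first lia.
    exists s1; eexists; split.
    + by apply: EIfT E1; rewrite (eval_cex HM we).
    + by apply: represents_le R1; lia.
    + by rewrite leq_add // (leq_trans T1) // leq_addr.
  have [|s1 [t1 [E1 R1 T1]]] := IHq b s h wq Kb HK _ Hr; first lia.
  exists s1; eexists; split.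
  + by apply: EIfF E1; rewrite (eval_cex HM we).
  + by apply: represents_le R1; lia.
  + by rewrite leq_add // (leq_trans T1) // leq_addl.
case/and5P => Hx Hbd bdp xp /andP[xw wp] Kb HK /= bm_ge Hr.
have nxbd : (bd == x) = false by apply/negbTE; apply: contra xp => /eqP <-.
have bdw : bd \notin writes p by apply: wf_writes bdp.
have [|s0 [t0 [E0 R0 T0]]] := represents_put (i := HC 0) (e := HC 0) (b' := b)
  Hx isT isT _ (leqnn b) Hr.
  by rewrite /= /bits absz0 expn_gt0.
set N := natof (ar h bd 0); set g := grow p K.
have NK : (N <= K)%N by move: (HK bd bdp); rewrite /N;
  case: (ar h bd 0) => z //=; lia.
set F := (fun h0 : hst => _); set h0 := setx h x 0 0.
(* State after [i] iterations: the loop bound is unchanged, the counter is [i], and the protected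
   arrays still respect [K]. *)
pose st i := iter i F h0.
have stS i : st i.+1 = F (st i) by [].
have stbd i : ar (st i) bd 0 = ar h bd 0.
  elim: i => [|i IH]; first by rewrite /= /upd nxbd.
  by rewrite stS /= /upd nxbd /= run_frame.
have stx i : ar (st i) x 0 = i%:Z.
  elim: i => [|i IH]; first by rewrite /= /upd !eqxx.
  by rewrite stS /= /upd !eqxx /= run_frame // IH; lia.
have stprot i y : y \in prot -> ar (st i) y 0 <= K%:Z.
  move=> yp; elim: i => [|i IH].
    rewrite /= /upd; case: eqP => [yx|_] /=; last exact: HK.
    by rewrite -yx yp in xp.
  rewrite stS /= /upd; case: eqP => [yx|_] /=; first by rewrite -yx yp in xp.
  by rewrite run_frame // (wf_writes wp).
pose W := While (for_test x bd) (Seq (comp p) (Store (for_incr x).1 (for_incr x).2)).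
have test i s1 : models (cells s1) (ar (st i)) ->
    eval (cells s1) (for_test x bd) = (i.+1%:Z <= ar h bd 0)%R%:Z.
  move=> HM; rewrite (eval_cex HM) /=; last by rewrite Hx Hbd.
  by rewrite stx stbd; congr (nat_of_bool (_ <= _)%R)%:Z; lia.
have testc i s1 : (i <= N)%N -> represents (b + i * g) s1 (st i) ->
    (expr_cost (cells s1) (for_test x bd) <= ecost (for_test x bd) bm)%N.
  move=> iN [_ _ _ Hb _]; apply: expr_cost_le (noquot_cex _) => j.
  by apply: bits_le (Hb j);
    rewrite (leq_trans _ bm_ge) // leq_add2l leq_mul2r (leq_trans iN NK) orbT.
(* Induction on the number [d] of iterations still to be done. *)
have loop d i s1 : (i + d = N)%N -> represents (b + i * g) s1 (st i) ->
    exists s' t, [/\ exec W s1 s' t, represents (b + N * g) s' (st N) &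
      (t <= d * (ecost (for_test x bd) bm + (time p K bm + scost (for_incr x) bm)) +
        ecost (for_test x bd) bm)%N].
  elim: d i s1 => [|d IHd] i s1 idN Ri.
    have iN : i = N by lia.
    rewrite iN in Ri *; have [HM _ _ _ _] := Ri.
    exists s1, (expr_cost (cells s1) (for_test x bd)); split=> //.
      apply: EWhileF; rewrite (test _ _ HM).
      by rewrite /N; case: (ar h bd 0) => z //=; rewrite lez_nat ltnn.
    by apply: (testc N).
  have [HM _ _ _ _] := Ri.
  have lim : (b + i.+1 * g <= bm)%N.
    by rewrite (leq_trans _ bm_ge) // leq_add2l leq_mul2r (leq_trans _ NK)
      ?orbT //; lia.
  have lim0 : (b + i * g + g <= bm)%N by move: lim; rewrite mulSn; lia.
  have Kbi : (K <= b + i * g)%N by lia.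
  have [s2 [t2 [E2 R2 T2]]] := IHp _ s1 (st i) wp Kbi (stprot i) lim0 Ri.
  have wx : ewf (HP (scal x) (HC 1)) by rewrite /= Hx.
  have bx : bits (b + i * g + g) (heval (ar (run p (st i))) (HP (scal x) (HC 1))).
    rewrite /= run_frame // stx (_ : _ + 1 = (i.+1)%:Z); last by lia.
    by apply: bits_nat; lia.
  have [s3 [t3 [E3 R3 T3]]] := represents_put (i := HC 0) Hx isT wx bx (leqnn _) R2.
  have R3' : represents (b + i.+1 * g) s3 (st i.+1).
    by have <- : (b + i * g + g = b + i.+1 * g)%N; first by rewrite mulSn; lia.
  have [|s4 [t4 [E4 R4 T4]]] := IHd i.+1 s3 _ R3'; first lia.
  exists s4; eexists; split; last 1 first.
  - rewrite mulSn -addnA; apply: leq_add; last exact: T4.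
    apply: leq_add; first by apply: (testc i s1 _ Ri); lia.
    apply: leq_add T2 (T3 _ lim0).
  - apply: EWhileT E4.
    + by rewrite (test _ _ HM); move: idN; rewrite /N;
      case: (ar h bd 0) => z /=; lia.
    + exact: ESeq E2 E3.
  - exact: R4.
have [||s' [t' [E' R' T']]] := loop N 0%N s0; first by [].
  by rewrite mul0n addn0.
exists s', (t0 + t')%N; split; first exact: ESeq E0 E'.
  by apply: represents_le R'; rewrite leq_add2l leq_mul2r NK orbT.
apply: leq_add; first by apply: T0; lia.
by apply: leq_trans T' _; rewrite leq_add2r leq_mul2r NK orbT.
Qed.

(** * Polynomial bounds *)

(** The base [x + 2] is at least 2 even for [x = 0], so that constants, sums and compositions are
    absorbed by a larger exponent. *)
Definition polybd (f : nat -> nat) := exists d, forall x, (f x <= (x + 2) ^ d)%N.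

Lemma leq_exp2r_wk m n e : (m <= n)%N -> (m ^ e <= n ^ e)%N.
Proof. by case: e => // e mn; rewrite leq_exp2r. Qed.

Lemma polybd_le f g : (forall x, (f x <= g x)%N) -> polybd g -> polybd f.
Proof. by move=> fg [d H]; exists d => x; apply: leq_trans (H x). Qed.

Lemma polybd_const c : polybd (fun=> c).
Proof.
exists c => x; apply: leq_trans (ltnW (ltn_expl c (isT : 1 < 2)%N)) _.
by rewrite leq_exp2r_wk ?leq_addl.
Qed.

Lemma polybd_id : polybd id.
Proof. by exists 1%N => x; rewrite expn1 leq_addr. Qed.

Lemma polybd_mul f g : polybd f -> polybd g -> polybd (fun x => f x * g x)%N.
Proof. by move=> [d Hd] [e He]; exists (d + e)%N => x; rewrite expnD leq_mul. Qed.

Lemma polybd_add f g : polybd f -> polybd g -> polybd (fun x => f x + g x)%N.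
Proof.
move=> [d Hd] [e He]; exists (d + e).+1 => x.
have x2 : (0 < x + 2)%N by lia.
have Hd' : (f x <= (x + 2) ^ (d + e))%N.
  by apply: leq_trans (Hd x) _; apply: leq_pexp2l => //; apply: leq_addr.
have He' : (g x <= (x + 2) ^ (d + e))%N.
  by apply: leq_trans (He x) _; apply: leq_pexp2l => //; apply: leq_addl.
by rewrite expnS; move: ((x + 2) ^ (d + e))%N Hd' He' => y; nia.
Qed.

Lemma polybd_succ f : polybd f -> polybd (fun x => (f x).+1).
Proof.
by move=> Hf; apply: polybd_le (polybd_add Hf (polybd_const 1)) => x; rewrite addn1.
Qed.

Lemma polybd_comp f g : polybd f -> polybd g -> polybd (fun x => f (g x)).
Proof.
move=> [d Hd] [e He]; exists (e.+2 * d)%N => x; apply: leq_trans (Hd _) _.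
rewrite expnM; apply: leq_exp2r_wk; have := He x.
have : (0 < (x + 2) ^ e)%N by rewrite expn_gt0 addnS.
by rewrite !expnS; move: ((x + 2) ^ e)%N => y; nia.
Qed.

Ltac polybd :=
  repeat first [assumption | exact: polybd_const | exact: polybd_id
    | apply: polybd_succ | apply: polybd_add | apply: polybd_mul].

Lemma polybd_ebits e : polybd (ebits e).
Proof. by elim: e => /= *; polybd. Qed.

Lemma polybd_ecost e : polybd (ecost e).
Proof.
elim: e => [z|e IH|e1 IH1 e2 IH2|e1 IH1 e2 IH2|e1 IH1 e2 IH2|e1 IH1 e2 IH2|e1
  IH1 e2 IH2];
 rewrite /=; polybd; exact: polybd_ebits.
Qed.

Lemma polybd_scost c : polybd (scost c).
Proof. by rewrite /scost; polybd;
  do ?[exact: polybd_ebits | exact: polybd_ecost]. Qed.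

Lemma polybd_rcost e : polybd (rcost e).
Proof. by rewrite /rcost; polybd;
  do ?[exact: polybd_ebits | exact: polybd_ecost]. Qed.

Lemma polybd_grow p : polybd (grow p).
Proof. by elim: p => /= *; polybd. Qed.

Lemma polybd_time p f g : polybd f -> polybd g -> polybd (fun x => time p (f x)
  (g x)).
Proof.
move=> Hf Hg.
have Ec e : polybd (fun x => ecost e (g x)) := polybd_comp (polybd_ecost e) Hg.
have Eb e : polybd (fun x => ebits e (g x)) := polybd_comp (polybd_ebits e) Hg.
have Sc c : polybd (fun x => scost c (g x)) := polybd_comp (polybd_scost c) Hg.
have Rc c : polybd (fun x => rcost c (g x)) := polybd_comp (polybd_rcost c) Hg.
elim: p => [|a i e|a i|e|p IHp q IHq|e p IHp q IHq|x b p IHp]; cbn [time];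
  repeat first [assumption | exact: polybd_const | apply: Ec | apply: Eb | apply: Sc
    | apply: Rc | apply: polybd_succ | apply: polybd_add | apply: polybd_mul].
Qed.

Lemma polybd_poly f : polybd f -> exists p : {poly nat}, forall x, (f x <= p.[x])%N.
Proof.
move=> [d Hd]; exists (('X + 2%:P) ^+ d) => x.
by rewrite horner_exp hornerD hornerX hornerC natrXE.
Qed.

Definition hstart (I : instance) : hst := HSt (fun _ _ => 0) (encode I) [::].

Lemma represents_start I b : (input_size I <= b)%N -> represents b (start I)
  (hstart I).
Proof.
move=> Ib; split=> //= [j|z zI]; first by rewrite /bits absz0 expn_gt0.
apply: bits_le (bits_bitlen z); apply: leq_trans Ib.
by rewrite /input_size (big_rem z) //= leq_addr.
Qed.

(** The loop bounds have to be computed before they are protected. Hence the split into a loop-free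
    [pre], which stores them, and [p], which may loop over them. Determinism carries the output over
    to every execution. *)
Lemma comp_polynomial (prot : seq nat) (c : nat) (pre p : prog) :
  wf [::] pre -> wf prot p ->
  (forall I x, x \in prot ->
     ar (run pre (hstart I)) x 0 <= (c * (input_size I).+1)%N%:Z) ->
  polynomial_time (Seq (comp pre) (comp p)) /\
  forall I s t, exec (Seq (comp pre) (comp p)) (start I) s t ->
    out s = hout (run p (run pre (hstart I))).
Proof.
(* [K] dominates both the bit lengths on the input tape and the loop bounds. *)
move=> wpre wp Hb; pose K x := (c.+1 * x.+1)%N.
have HK : polybd K by rewrite /K; polybd.
pose b1 x := (K x + grow pre (K x))%N; pose b2 x := (b1 x + grow p (K x))%N.
have Hb1 : polybd b1 by apply: polybd_add => //;
  apply: polybd_comp (polybd_grow pre) HK.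
have Hb2 : polybd b2 by apply: polybd_add => //;
  apply: polybd_comp (polybd_grow p) HK.
have main I : exists s t, [/\ exec (Seq (comp pre) (comp p)) (start I) s t,
    out s = hout (run p (run pre (hstart I))) &
    (t <= time pre (K (input_size I)) (b1 (input_size I)) +
          time p (K (input_size I)) (b2 (input_size I)))%N].
  set x := input_size I.
  have R0 : represents (K x) (start I) (hstart I) by apply: represents_start;
    rewrite /K; nia.
  have [//|s1 [t1 [E1 R1 T1]]] := comp_run wpre (leqnn _) _ (leqnn _) R0.
  have [||s2 [t2 [E2 R2 T2]]] := comp_run (K := K x) wp _ _ (leqnn _) R1.
  - exact: leq_addr.
  - by move=> y /Hb H; apply: le_trans (H I) _; rewrite lez_nat /K leq_mul.
  exists s2, (t1 + t2)%N; split; first exact: ESeq E1 E2.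
    by have [_ _ -> _ _] := R2.
  exact: leq_add.
split.
  have [|P HP] := @polybd_poly (fun x => time pre (K x) (b1 x) + time p (K x)
    (b2 x))%N.
    by apply: polybd_add; apply: polybd_time.
  exists P => I; have [s [t [E _ T]]] := main I.
  by exists s, t; split=> //; apply: leq_trans T (HP _).
move=> I s t E; have [s' [t' [E' Ho _]]] := main I.
by have [<- _] := exec_det E' E.
Qed.

(** * Rounding *)

Lemma split_lshift m k (u : 'I_m) : split (lshift k u) = inl u.
Proof. exact: (unsplitK (inl u)). Qed.

Lemma split_rshift m k (z : 'I_k) : split (rshift m z) = inr z.
Proof. exact: (unsplitK (inr z)). Qed.

Lemma natz_sum (T : Type) (r : seq T) (P : pred T) (F : T -> nat) :
  (\sum_(i <- r | P i) F i)%N%:Z = \sum_(i <- r | P i) (F i)%:Z.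
Proof. exact: (big_morph Posz PoszD (erefl _)). Qed.

Definition near (I : instance) (a : rat) (p v : 'I_(npts I)) :=
  dist p v <= a * (radius p + radius v).

Definition half (I : instance) (p v : 'I_(npts I)) := radius p <= 2 * radius v.

Definition captures (I : instance) a (p v : 'I_(npts I)) := half p v && near a p v.

Definition edge (I : instance) a (u v : 'I_(npts I)) := near a u v && ~~ half u v.

Lemma dist_ge0 (I : instance) (u v : 'I_(npts I)) : 0 <= dist u v.
Proof.
have := dist_triangle u v u; rewrite (distC v u) (dist_eq0 u u).2 //; lra.
Qed.

Lemma near_sym (I : instance) a (u v : 'I_(npts I)) : near a u v = near a v u.
Proof. by rewrite /near distC addrC. Qed.

Lemma half_refl (I : instance) (u : 'I_(npts I)) : half u u.
Proof. by rewrite /half; have := radius_gt0 u; lra. Qed.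

(* The gain of making j the successor of i.  The nodes are the points followed
   by k auxiliary nodes, which cut a permutation of the nodes into at most k
   nontrivial chains of points; a forbidden successor costs more than all
   points together can pay. *)
Definition gain (I : instance) a k (w : 'I_(npts I) -> int)
    (i j : 'I_(npts I + k)) : int :=
  match split i with
  | inl u => match split j with
             | inl v => if u == v then 0 else if edge a u v then w u
                        else - (npts I)%:Z
             | inr _ => w u
             end
  | inr _ => 0
  end.

Section Rounding.
Variables (I : instance) (a : rat) (k : nat).
Hypothesis a_ge0 : 0 <= a.
Local Notation n := (npts I).

(** * From a permutation without forbidden successors to centers *)

Section Soundness.
Variables (s : {perm 'I_(n + k)}) (w : 'I_n -> int).
Hypothesis gain_s : forall i, 0 <= gain a w i (s i).

Definition sinks := [set u : 'I_n | (n <= s (lshift k u))%N].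

(** A permutation sends distinct sinks to distinct auxiliary nodes, and there are [k] of these. *)
Lemma card_sinks : (#|sinks| <= k)%N.
Proof.
pose f (u : 'I_n) : 'I_k + 'I_n := if split (s (lshift k u)) is inr z then inl
  z else inr u.
have fS u : u \in sinks -> exists2 z, s (lshift k u) = rshift n z & f u = inl z.
  rewrite inE /f => H; case: splitP => [j E|z E].
    by move: (ltn_ord j); rewrite -E ltnNge H.
  by exists z => //; apply: val_inj.
have inj : {in sinks &, injective f}.
  move=> u v /fS[z Ez ->] /fS[z' Ez' ->] [zz]; apply: (@lshift_inj n k).
  by apply: (@perm_inj _ s); rewrite Ez Ez' zz.
rewrite -(card_in_imset inj).
have sub : f @: sinks \subset [set inl z | z in 'I_k].
  by apply/subsetP => _ /imsetP[u /fS[z _ ->] ->]; apply/imsetP; exists z.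
rewrite (leq_trans (subset_leq_card sub)) //.
by rewrite card_imset ?card_ord // => ? ? [].
Qed.

Lemma gain_edge u v : s (lshift k u) = lshift k v -> u != v -> edge a u v.
Proof.
move=> E uv; have := gain_s (lshift k u).
rewrite E /gain !split_lshift (negPf uv); case: ifP => // _.
by rewrite oppr_ge0 lez_nat leqNgt (leq_ltn_trans _ (ltn_ord u)).
Qed.

(* The radii along a chain decrease by more than a factor 2, so the distances
   from a point to its successors sum up geometrically. *)
Lemma chain_to_sink u : s (lshift k u) != lshift k u ->
  exists2 t, t \in sinks & dist u t <= 3 * a * radius u.
Proof.
(* Induction on the number of points of smaller radius, which drops along an edge. *)
move: {2}_.+1 (ltnSn #|[set v : 'I_n | radius v < radius u]|) => N.
elim: N u => // N IH u ltN moved.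
case: (splitP (s (lshift k u))) => [v Ev|z Ez]; last first.
  exists u; first by rewrite inE Ez leq_addr.
  by rewrite (dist_eq0 u u).2 // !mulr_ge0 // ltW // radius_gt0.
have {}Ev : s (lshift k u) = lshift k v by apply: val_inj.
have uv : u != v by apply: contra moved => /eqP {2}->; rewrite Ev.
have /andP[nuv] := gain_edge Ev uv; rewrite /half -ltNge => ru.
have rv := radius_gt0 v.
have [||t tS dt] := IH v.
- rewrite ltnS in ltN; apply: leq_trans ltN; apply: proper_card; apply/properP;
  split.
    by apply/subsetP => x; rewrite !inE => ?; lra.
  by exists v; rewrite !inE ?ltxx //; lra.
- by apply: contra uv => /eqP E; apply/eqP/(@lshift_inj n k)/(@perm_inj _ s);
  rewrite E.
exists t => //; have := dist_triangle u v t; move: nuv; rewrite /near => nuv tri.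
(* With R the radius of [u] and r < R/2 that of [v], the distance is at most a(R + r) + 3ar = aR +
   4ar, hence at most 3aR. The factor 3 is the solution of c = 1 + (1 + c)/2. *)
have : a * (2 * radius v) <= a * radius u by apply: ler_wpM2l => //; lra.
lra.
Qed.

(** A capturing point moved by [s] lies on a chain and so has a sink nearby; the triangle inequality
    through [u] does the rest. *)
Lemma moved_covered u v : captures a u v -> s (lshift k u) != lshift k u ->
  v \in covered sinks (9 * a).
Proof.
case/andP => huv nuv /chain_to_sink[t tS dt]; rewrite inE.
apply/dist_setP; exists t => //.
have := dist_triangle v u t; rewrite (distC v u); move: nuv huv;
  rewrite /near /half => nuv huv tri.
have : a * radius u <= a * (2 * radius v) by apply: ler_wpM2l.
lra.
Qed.

End Soundness.

(** * From an unknown set of centers to a permutation of large gain *)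

Section Completeness.
Variables (own : 'I_n -> 'I_n) (S : {set 'I_n}).
Let w u : int := #|[set v | own v == u]|%:Z.
Hypothesis sep : forall u v, 0 < w u -> 0 < w v -> u != v ->
  ~~ captures a u v || ~~ captures a v u.
Hypothesis S_le : (#|S| <= k)%N.
Let C := covered S a.

(** One center is chosen for each covered point, so that the points of [C] split into at most [k]
    classes. The default [u] is only reached outside [C]. *)
Let center (u : 'I_n) : 'I_n :=
  odflt u [pick s in S | dist u s <= a * radius u].

Lemma centerP u : u \in C -> center u \in S /\ dist u (center u) <= a * radius u.
Proof.
rewrite inE => /dist_setP[s sS ds]; rewrite /center; case: pickP => [t /andP[]//|].
by move/(_ s); rewrite sS ds.
Qed.

Lemma near_center u v : u \in C -> v \in C -> center u = center v -> near a u v.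
Proof.
move=> /centerP[_ du] /centerP[_ dv] E; rewrite /near.
have := dist_triangle u (center u) v; rewrite (distC (center u) v);
  rewrite -E in dv; lra.
Qed.

Let active u := (u \in C) && (0 < w u).

(** The two points are near each other through their center. As the radius of [v] is not larger, [v]
    captures [u]; by separation [u] does not capture [v], and only the condition on the radii can
    fail. *)
Lemma active_edge u v : active u -> active v -> center u = center v -> u != v ->
  radius v <= radius u -> edge a u v.
Proof.
move=> /andP[uC wu] /andP[vC wv] E uv rvu; have nuv := near_center uC vC E.
have := sep wu wv uv; rewrite /edge /captures (near_sym _ v u) nuv !andbT /=.
by case/orP => // /negP[]; rewrite /half; have := radius_gt0 u; lra.
Qed.

Lemma idx_proof u : u \in C -> (index (center u) (enum S) < k)%N.
Proof.
move=> /centerP[cS _]; apply: leq_trans S_le.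
by rewrite cardE index_mem mem_enum.
Qed.

(** The classes become the cycles of the permutation. An active point is sent to the auxiliary node
    with the number of its center; [insubd] does not fall back to its default there, by [idx_proof].
    All other nodes are alone or represent a class. *)
Let cls (i : 'I_(n + k)) : 'I_(n + k) :=
  if split i is inl u then
    (if active u then insubd i (n + index (center u) (enum S))%N else i)
  else i.

Lemma cls_active u : active u ->
  exists2 z : 'I_k, cls (lshift k u) = rshift n z & z = index (center u) (enum
    S) :> nat.
Proof.
move=> au; have /andP[uC _] := au.
exists (Ordinal (idx_proof uC)) => //; rewrite /cls split_lshift au; apply: val_inj.
by rewrite val_insubd ltn_add2l (idx_proof uC).
Qed.

Lemma cls_inactive u : ~~ active u -> cls (lshift k u) = lshift k u.
Proof. by rewrite /cls split_lshift => /negPf ->. Qed.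

Lemma cls_rshift z : cls (rshift n z) = rshift n z.
Proof. by rewrite /cls split_rshift. Qed.

Lemma cls_cls i : cls (cls i) = cls i.
Proof.
rewrite -(splitK i); case: (split i) => [u|z] /=; last by rewrite !cls_rshift.
have [/cls_active[z -> _]|/cls_inactive E] := boolP (active u);
  first exact: cls_rshift.
by rewrite !E.
Qed.

Let key (i : 'I_(n + k)) : rat := if split i is inl u then radius u else 0.
(** The points of a class by decreasing radius. The auxiliary node put in front of them in [cyc]
    closes the cycle, at no cost. *)
Let chain z := sort (fun i j => key j <= key i)
  [seq i <- enum 'I_(n + k) | (cls i == z) && (i != z)].
Let cyc z := z :: chain z.

Lemma mem_chain z i : (i \in chain z) = (cls i == z) && (i != z).
Proof. by rewrite mem_sort mem_filter mem_enum andbT. Qed.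

Lemma uniq_cyc z : uniq (cyc z).
Proof. by rewrite /= mem_chain eqxx andbF sort_uniq filter_uniq ?enum_uniq. Qed.

Lemma mem_cyc i : i \in cyc (cls i).
Proof. by rewrite inE mem_chain eqxx /=; case: eqVneq. Qed.

Lemma cls_cyc i j : j \in cyc (cls i) -> cls j = cls i.
Proof. by rewrite inE mem_chain => /orP[/eqP->|/andP[/eqP]] //; rewrite cls_cls. Qed.

Let succ i := next (cyc (cls i)) i.

Lemma cls_succ i : cls (succ i) = cls i.
Proof. by apply: cls_cyc; rewrite mem_next mem_cyc. Qed.

(** [succ] preserves classes, and within the duplicate-free list of a class [next] is inverted by
    [prev]. *)
Lemma succ_inj : injective succ.
Proof.
move=> i j E; have C2 : cls i = cls j by rewrite -cls_succ E cls_succ.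
move: E; rewrite /succ C2; exact: (can_inj (prev_next (uniq_cyc (cls j)))).
Qed.

Let ok (i j : 'I_(n + k)) :=
  if split i is inl u then (if split j is inl v then edge a u v else true) else true.

Lemma chain_active (z : 'I_k) i : i \in chain (rshift n z) ->
  exists2 u, i = lshift k u & active u /\ z = index (center u) (enum S) :> nat.
Proof.
rewrite mem_chain => /andP[/eqP E ne].
rewrite -(splitK i) in E ne *; case: (split i) E ne => [u|y] /= E ne; last first.
  by rewrite cls_rshift in E; rewrite E eqxx in ne.
exists u => //; have [au|nu] := boolP (active u).
  have [y Ey yE] := cls_active au; split=> //.
  by move: Ey; rewrite E => /(@rshift_inj n k) ->.
by rewrite cls_inactive // in E; move: (congr1 split E);
  rewrite split_lshift split_rshift.
Qed.

Lemma cycle_ok (z : 'I_k) : cycle ok (cyc (rshift n z)).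
Proof.
rewrite /= rcons_path; apply/andP; split; last by rewrite /ok split_rshift;
  case: split.
suff: sorted ok (chain (rshift n z)).
  by case: chain => //= x s ->; rewrite {1}/ok split_rshift.
have tr : transitive (fun i j => key j <= key i) by move=> x y t H1 H2;
  apply: le_trans H2 H1.
have tot : total (fun i j => key j <= key i) by move=> x y; apply: le_total.
have := sort_sorted tot [seq i <- enum 'I_(n + k) | (cls i == rshift n z) && (i
  != rshift n z)].
rewrite -/(chain _) => sch.
have := uniq_cyc (rshift n z); rewrite /= => /andP[_ uch].
(* Sortedness alone allows equal neighbours; distinctness is added because [active_edge] concerns
   different points. *)
have pw : pairwise (fun i j => (key j <= key i) && (i != j)) (chain (rshift n z)).
  by rewrite pairwise_relI -sorted_pairwise // sch /=; move: uch;
    rewrite uniq_pairwise.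
apply: (pairwise_sorted (e := ok)).
apply: (sub_in_pairwise (P := mem (chain (rshift n z)))) pw; last exact/allP.
move=> i j /chain_active[u -> [au Eu]] /chain_active[v -> [av Ev]].
rewrite /key /ok !split_lshift => /andP[ruv uv].
have mS x : active x -> center x \in enum S.
  by case/andP => /centerP[cS _] _; rewrite mem_enum.
have cuv : center u = center v.
  by rewrite -(nth_index u (mS u au)) -(nth_index u (mS v av)) -Eu -Ev.
apply: active_edge au av cuv _ ruv; by apply: contra uv => /eqP ->.
Qed.

Lemma gain_active u : active u -> gain a w (lshift k u) (succ (lshift k u)) = w u.
Proof.
move=> au; have [z Ez _] := cls_active au.
have : ok (lshift k u) (succ (lshift k u)).
  by apply: next_cycle; [rewrite Ez; apply: cycle_ok | apply: mem_cyc].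
rewrite /ok /gain split_lshift; case: split => // v e; rewrite e; case: eqP => // uv.
by move: e; rewrite -uv /edge half_refl andbF.
Qed.

Lemma gain_inactive u : ~~ active u -> gain a w (lshift k u) (succ (lshift k u)) = 0.
Proof.
move=> nu; suff -> : succ (lshift k u) = lshift k u by rewrite /gain
  !split_lshift eqxx.
have := cls_succ (lshift k u); rewrite (cls_inactive nu).
move: (succ _) => j; rewrite -(splitK j); case: (split j) => [v|z] /=;
  last by rewrite cls_rshift.
have [/cls_active[z -> _] E|/cls_inactive ->//] := boolP (active v).
by move: (congr1 split E); rewrite split_lshift split_rshift.
Qed.

(** Following [succ], each active point gains its weight and every other node gains 0. The points of
    [C] that are not active have weight 0, so nothing of the sum over [C] is lost. *)
Lemma exists_perm_gain :
  exists t : {perm 'I_(n + k)}, \sum_i gain a w i (t i) = \sum_(u in C) w u.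
Proof.
exists (perm succ_inj); rewrite big_split_ord /= [X in _ + X]big1 ?addr0; last first.
  by move=> z _; rewrite /gain split_rshift.
rewrite [RHS]big_mkcond /=; apply: eq_bigr => u _; rewrite permE.
have [au|nu] := boolP (active u).
  by rewrite gain_active //; have /andP[-> _] := au.
rewrite gain_inactive //; case: ifP => // uC; move: nu; rewrite /active uC /=.
by rewrite /w ltz_nat -leqNgt leqn0 => /eqP ->.
Qed.

(** By optimality the weight of [C] is at most the gain of [s], which is at most the total weight of
    the moved points. *)
Lemma weight_bound (s : {perm 'I_(n + k)}) (m : int) :
  0 < m ->
  (forall t : {perm 'I_(n + k)}, \sum_i gain a w i (t i) <= \sum_i gain a w i
    (s i)) ->
  (forall i, 0 <= gain a w i (s i)) ->
  #|[set v | s (lshift k (own v)) != lshift k (own v)]|%:Z < m ->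
  \sum_(u in C) w u < m.
Proof.
move=> m0 opt gs; apply: le_lt_trans; have [t <-] := exists_perm_gain.
apply: le_trans (opt t) _.
rewrite big_split_ord /= [X in _ + X]big1 ?addr0; last first.
  by move=> z _; rewrite /gain split_rshift.
(* Grouping the points by their capturing point turns the cardinal into a sum of weights. *)
have -> : #|[set v | s (lshift k (own v)) != lshift k (own v)]|%:Z =
    \sum_u (if s (lshift k u) != lshift k u then w u else 0).
  rewrite -sum1_card natz_sum /= big_mkcond /= [LHS](partition_big own xpredT) //=.
  apply: eq_bigr => u _;
    rewrite (eq_bigr (fun v => if s (lshift k u) != lshift k u then 1 else 0)).
    case: ifP => _; last by rewrite big1.
    by rewrite /w -sum1_card natz_sum; apply: eq_bigl => v; rewrite inE.
  by move=> v /eqP <-; rewrite inE.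
apply: ler_sum => u _; rewrite /gain split_lshift.
case: (splitP (s (lshift k u))) => [v Ev|z Ez].
  have -> : s (lshift k u) = lshift k v by apply: val_inj.
  case: eqVneq => [->|uv]; first by rewrite eqxx.
  have -> /= : lshift k v != lshift k u by apply: contra uv =>
    /eqP/(@lshift_inj n k) ->.
  case: ifP => // _; apply: (@le_trans _ _ 0); first by rewrite oppr_le0.
  by rewrite /w.
have -> // : s (lshift k u) != lshift k u.
by apply/eqP => E; move: Ez; rewrite E /= => H; have := ltn_ord u; rewrite H; lia.
Qed.

(** All weights together sum to [n], which is the price of a single forbidden successor. So the
    optimal gain is at most 0, and the weight of [C] with it. *)
Lemma forbidden_bound (s : {perm 'I_(n + k)}) (m : int) i :
  0 < m ->
  (forall t : {perm 'I_(n + k)}, \sum_i gain a w i (t i) <= \sum_i gain a w i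
    (s i)) ->
  gain a w i (s i) < 0 ->
  \sum_(u in C) w u < m.
Proof.
move=> m0 opt gi; have [t <-] := exists_perm_gain; apply: le_lt_trans (opt t) _.
apply: le_lt_trans m0.
have sw : \sum_u w u = n%:Z.
  transitivity (\sum_(v : 'I_n) 1%:Z);
    last by rewrite sumr_const card_ord -mulr_natl natz mulr1.
  rewrite [RHS](partition_big own xpredT) //=; apply: eq_bigr => u _.
  by rewrite /w -sum1_card natz_sum; apply: eq_bigl => v; rewrite inE.
have w0 u : 0 <= w u by [].
have gw u j : gain a w (lshift k u) j <= w u.
  rewrite /gain split_lshift; case: split => // v; case: ifP => // _;
    case: ifP => // _.
  by apply: le_trans (w0 u); rewrite oppr_le0.
rewrite big_split_ord /= [X in _ + X]big1 ?addr0; last first.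
  by move=> z _; rewrite /gain split_rshift.
move: gi; rewrite -(splitK i); case: (split i) => [u|z] /=;
  last by rewrite /gain split_rshift ltxx.
move=> gu; rewrite (bigD1 u) //=.
have -> : gain a w (lshift k u) (s (lshift k u)) = - n%:Z.
  move: gu; rewrite /gain split_lshift; case: split => [v|_];
    last by rewrite ltNge w0.
  by case: ifP => //; case: ifP => // _ _; rewrite ltNge w0.
rewrite addrC subr_le0 -sw [leRHS](bigD1 u) //=; apply: ler_wpDl => //.
exact: ler_sum.
Qed.

End Completeness.
End Rounding.

(** * The perceptron *)

Section Perceptron.
Variables (n : nat) (C : {set 'I_n}).

Definition perceptron (t : nat) (c : 'I_n -> int) :=
  \sum_v c v ^+ 2 <= t%:Z * n%:Z ^+ 2 /\ t%:Z <= \sum_(v in C) c v.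

Lemma perceptron0 : perceptron 0 (fun=> 0).
Proof. by split; rewrite big1 // => v _; rewrite expr0n. Qed.

Lemma perceptron_step t (c : 'I_n -> int) (own : 'I_n -> 'I_n) :
  let w u : int := #|[set v | own v == u]|%:Z in
  (forall v, c v <= c (own v)) -> \sum_(u in C) w u < #|C|%:Z ->
  perceptron t c -> perceptron t.+1 (fun v => c v + (1 - w v)).
Proof.
move=> w cown wC [c2 ct].
have sumw (f : 'I_n -> int) : \sum_u w u * f u = \sum_v f (own v).
  rewrite [RHS](partition_big own xpredT) //=; apply: eq_bigr => u _.
  rewrite (eq_bigr (fun=> f u)); last by move=> v /eqP ->.
  rewrite sumr_const -[RHS]mulr_natl /w natz; congr (_%:Z * _).
  by apply: eq_card => v; rewrite inE.
split.
  (* The cross terms sum to at most 0, because the sum of [w v * c v] equals that of [c (own v)]. *)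
  rewrite (eq_bigr (fun v => c v ^+ 2 + (2 * (c v - w v * c v) + (1 - w v) ^+
    2))); last first.
    by move=> v _; ring.
  have -> : t.+1%:Z = t%:Z + 1 by lia.
  rewrite big_split /= mulrDl mul1r; apply: lerD => //.
  rewrite big_split /= -[leRHS]add0r; apply: lerD.
    rewrite -mulr_sumr pmulr_rle0 // sumrB sumw subr_le0; exact: ler_sum.
  (* The weights sum to [n] and each is at most [n], so their squares sum to at most the square of
     [n]; passing from [w] to [1 - w] does not increase this. *)
  have -> : n%:Z ^+ 2 = \sum_(u < n) w u * n%:Z.
    by rewrite sumw sumr_const card_ord -mulr_natl natz expr2.
  have wn u : w u <= n%:Z by rewrite lez_nat -[leqRHS]card_ord max_card.
  have sw1 : \sum_u w u = \sum_(u < n) 1.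
    by rewrite -(eq_bigr _ (fun u _ => mulr1 (w u))) sumw.
  rewrite (eq_bigr (fun v => w v * w v - w v + (1 - w v))); last by move=> v _; ring.
  rewrite big_split /= sumrB [X in _ + X]sumrB sw1 subrr addr0.
  rewrite lerBlDr; apply: ler_wpDr; first by apply: sumr_ge0.
  by apply: ler_sum => u _; apply: ler_wpM2l.
rewrite big_split /= sumrB sumr_const -mulr_natl natz mulr1.
have -> : t.+1%:Z = t%:Z + 1 by lia.
by apply: lerD => //; rewrite -gtz0_ge1 subr_gt0.
Qed.

(* Cauchy-Schwarz, in the form 0 <= |c - n^2 1_C|^2. *)
Lemma perceptron_bound t c : perceptron t c -> (t <= n ^ 3)%N.
Proof.
move=> [c2 ct].
have H : 0 <= \sum_v (c v - (if v \in C then n%:Z ^+ 2 else 0)) ^+ 2.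
  by apply: sumr_ge0 => v _; apply: sqr_ge0.
rewrite (eq_bigr (fun v => c v ^+ 2 + (if v \in C then n%:Z ^+ 4 - 2 * n%:Z ^+
  2 * c v else 0))) in H;
  last by move=> v _; case: ifP => _; ring.
rewrite big_split /= -big_mkcond /= sumrB sumr_const -mulr_sumr -[_ ^+ 4 *+
  _]mulr_natl natz in H.
have Cn : (#|C|%:Z <= n%:Z) by rewrite lez_nat -[leqRHS]card_ord max_card.
have [n0|n0] := posnP n.
  move: ct; rewrite big1 => [|v _];
    last by have := leq_trans (ltn_ord v) (eq_leq n0).
  by rewrite lez_nat leqn0 => /eqP ->.
rewrite -lez_nat -[(n ^ 3)%N%:Z]natz natrX natz.
have N0 : 0 < n%:Z by [].
move: (\sum_(v in C) c v) (\sum_v c v ^+ 2) (#|C|%:Z) (n%:Z) (t%:Z) Cn N0 ct c2 H.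
move=> x y z N T zN N0 Tx yT H.
(* The expanded square gives 0 <= T N^2 - 2 N^2 T + N^5, that is, N^2 T <= N^2 N^3. *)
rewrite -(ler_pM2l (exprn_gt0 2 N0)).
have h1 : N ^+ 2 * T <= N ^+ 2 * x by rewrite ler_pM2l ?exprn_gt0.
have h2 : z * N ^+ 4 <= N * N ^+ 4 by rewrite ler_pM2r ?exprn_gt0.
have -> : N ^+ 2 * N ^+ 3 = N * N ^+ 4 by ring.
lra.
Qed.

End Perceptron.

(** * Program logic *)

(** Invariant rule. By [run_frame] the body may be examined under the assumption that all arrays not
    written by the loop still have their initial contents. *)
Lemma run_for (J : nat -> hst -> Prop) x b p h k :
  x \notin writes p -> ar h b 0 = k%:Z ->
  J 0%N (setx h x 0 0) ->
  (forall i h', (i < k)%N -> ar h' x 0 = i%:Z ->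
     (forall a j, a \notin x :: writes p -> ar h' a j = ar h a j) ->
     J i h' -> J i.+1 (setx (run p h') x 0 i.+1%:Z)) ->
  J k (run (PFor x b p) h).
Proof.
move=> xp Hk J0 JS; rewrite /= Hk /=.
set F := (fun h0 : hst => _).
have Hx i : ar (iter i F (setx h x 0 0)) x 0 = i%:Z.
  elim: i => [|i IH]; first by rewrite /= /upd !eqxx.
  by rewrite iterS [ar _]/= /upd !eqxx /= run_frame // IH -PoszD addn1.
have Hf i a j : a \notin x :: writes p -> ar (iter i F (setx h x 0 0)) a j = ar
  h a j.
  move=> ax; move: (ax); rewrite inE negb_or => /andP[/negPf ax' ap].
  elim: i => [|i IH]; first by rewrite /= /upd ax'.
  by rewrite iterS [ar _]/= /upd ax' /= run_frame.
suff H i : (i <= k)%N -> J i (iter i F (setx h x 0 0)) by apply: H.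
elim: i => // i IH ik; have := JS i _ ik (Hx i) (Hf i) (IH (ltnW ik)).
by rewrite iterS {2}/F run_frame // Hx -PoszD addn1.
Qed.

(** Nested loops over one bound repeat [p] as often as the [d]-th power of that bound. Polynomially
    many iterations are thus obtained from linear loop bounds. *)
Fixpoint rep (ctr b d : nat) (p : prog) : prog :=
  if d is d'.+1 then PFor (ctr + d')%N b (rep ctr b d' p) else p.

(** The counters of the nest are [ctr], ..., [ctr + d - 1]; the invariant has to ignore them. *)
Lemma run_rep (J : nat -> hst -> Prop) ctr b d p h t k :
  (forall x v h t, (ctr <= x < ctr + d)%N -> J t h -> J t (setx h x 0 v)) ->
  (forall t h, J t h -> J t.+1 (run p h)) ->
  (forall t h, J t h -> ar h b 0 = k%:Z) ->
  J t h -> J (t + k ^ d)%N (run (rep ctr b d p) h).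
Proof.
move=> Jx Jp Jb; elim: d t h Jx => [|d IH] t h Jx Jh; first by rewrite addn1;
  apply: Jp.
rewrite /= (Jb _ _ Jh) /=.
set F := (fun h0 : hst => _).
suff H i : J (t + i * k ^ d)%N (iter i F (setx h (ctr + d) 0 0)) by rewrite
  expnS; apply: H.
elim: i => [|i IHi]; first by rewrite addn0; apply: Jx => //; lia.
rewrite iterS /F; apply: (Jx); first by lia.
rewrite mulSn [(k ^ d + _)%N]addnC addnA; apply: IH IHi => x v h' t' xd.
by apply: Jx; lia.
Qed.

Definition pseq (s : seq prog) : prog := foldr PSeq PSkip s.

(** * The auction *)

(* Bidding with unit increments on values scaled by more than the number of
   bidders finds an optimal assignment. *)
Lemma auction_optimal N (x : 'I_N -> 'I_N -> int) (q : 'I_N -> int) (s t :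
  {perm 'I_N}) :
  (forall i j, N.+1%:Z * x i j - q j - 1 <= N.+1%:Z * x i (s i) - q (s i)) ->
  \sum_i x i (t i) <= \sum_i x i (s i).
Proof.
move=> H; have : \sum_i (N.+1%:Z * x i (t i) - q (t i) - 1) <=
    \sum_i (N.+1%:Z * x i (s i) - q (s i)) by apply: ler_sum.
rewrite [leLHS]sumrB !sumrB -!mulr_sumr -!(reindex_inj perm_inj (P := xpredT)
  (F := q)) /=.
rewrite sumr_const card_ord -[1 *+ N]mulr_natl natz mulr1.
(* The prices cancel and the slacks add up to [N]. So [N + 1] times the difference of two integers
   is at most [N], and the difference is at most 0. *)
move: (\sum_i x i (t i)) (\sum_i x i (s i)) (\sum_i q i) => a b c; nia.
Qed.

Section AuctionStep.
Variables (N : nat) (x : 'I_N -> 'I_N -> int) (B : int).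
Let K : int := N.+1%:Z.
Hypothesis x_le : forall i j, `|x i j| <= B.

Definition best_for (pr : 'I_N -> int) i j :=
  forall o, K * x i o - pr o <= K * x i j - pr j.

(* pr: prices; holder j: the bidder holding object j; item i: the object held
   by bidder i; -1 stands for none. *)
Definition auction_inv (t : nat) (pr holder item : 'I_N -> int) :=
  [/\ forall j, (holder j = -1 /\ pr j = 0) \/ exists i : 'I_N,
        [/\ holder j = i%:Z, item i = j%:Z &
            forall o, K * x i o - pr o - 1 <= K * x i j - pr j],
      forall i, item i = -1 \/ exists2 j : 'I_N, item i = j%:Z & holder j = i%:Z,
      forall j, 0 <= pr j <= 2 * B * K + 1 &
      (forall i, 0 <= item i) \/ t%:Z <= \sum_j pr j].

(** Pigeonhole: if every object were held, the holders would exhaust the bidders, including [i]. An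
    object without holder still has price 0. *)
Lemma free_object t pr holder item (i : 'I_N) :
  auction_inv t pr holder item -> item i = -1 ->
  exists2 j : 'I_N, holder j = -1 & pr j = 0.
Proof.
move=> [H1 H2 _ _] Hi.
have [/existsP[j /eqP Hj]|no] := boolP [exists j, holder j == -1].
  by exists j => //; case: (H1 j) => [[]//|[b []]]; rewrite Hj.
have H j : exists b : 'I_N, holder j = b%:Z /\ item b = j%:Z.
  case: (H1 j) => [[Hj _]|[b [? ? _]]]; last by exists b.
  by move: no; rewrite negb_exists => /forallP/(_ j); rewrite Hj.
have [f Hf] := fin_all_exists H.
have finj : injective f.
  by move=> j j' E; apply: val_inj; have := (Hf j).2; rewrite E (Hf j').2 => -[].
have := Hf (finv f i); rewrite (f_finv finj) Hi => -[_ //].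
Qed.

(** Before the bid [j] is a best object for [i], so after its price rises by 1 it is still within 1
    of the best. For the other holders only competing prices rise. The sum of the prices increases
    by 1, which measures progress. *)
Lemma auction_stepP t pr holder item (pr' holder' item' : 'I_N -> int) (i j : 'I_N) :
  auction_inv t pr holder item -> item i = -1 -> best_for pr i j ->
  (forall o, pr' o = if o == j then pr o + 1 else pr o) ->
  (forall o, holder' o = if o == j then i%:Z else holder o) ->
  (forall b, item' b = if b == i then j%:Z else
                       if holder j == b%:Z then -1 else item b) ->
  auction_inv t.+1 pr' holder' item'.
Proof.
move=> inv Hi best Hp Hh Hm; have [o Ho po] := free_object inv Hi.
have [H1 H2 H3 H4] := inv.
have pr_le o' : pr o' <= pr' o' by rewrite Hp; case: ifP => _; lia.
have item_cases (j' b : 'I_N) : holder j' = b%:Z -> item b = j'%:Z -> j' != j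
  -> item' b = j'%:Z.
  move=> hb ib jj; rewrite Hm; case: eqP => [bi|_]; first by move: ib; rewrite bi Hi.
  case: eqP => // hj; case: (H1 j) => [[]|[b' [hb' ib' _]]]; first by rewrite hj.
  move: hj; rewrite hb' => -[/val_inj bb]; move: ib'; rewrite bb ib => -[/val_inj E].
  by rewrite E eqxx in jj.
split.
- move=> j'; rewrite Hh; case: eqVneq => [->|jj].
    right; exists i; split=> //; first by rewrite Hm eqxx.
    by move=> o'; have := best o'; have := pr_le o'; rewrite !Hp eqxx; lia.
  case: (H1 j') => [[hj pj]|[b [hb ib lb]]]; first by left; rewrite Hp (negPf jj).
  right; exists b; split=> //; first exact: item_cases.
  by move=> o'; have := lb o'; have := pr_le o'; rewrite [pr' j']Hp (negPf jj); lia.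
- move=> b; rewrite Hm; case: eqVneq => [->|bi].
    by right; exists j; rewrite // Hh eqxx.
  case: eqP => [|hj]; first by left.
  case: (H2 b) => [|[j' ib hb]]; first by left.
  right; exists j' => //; rewrite Hh; case: eqP => // jj; by rewrite -jj hb in hj.
- move=> j'; rewrite Hp; case: eqVneq => [->|_]; last exact: H3.
  (* Comparison with the free object [o], of price 0, bounds the old price of [j] by [2 * B * K];
     the bid adds 1. *)
  have /andP[pj _] := H3 j; have := best o; rewrite po.
  have := x_le i o; have := x_le i j; rewrite !ler_norml.
  have K0 : 0 <= K by [].
  move: (x i o) (x i j) (pr j) K pj K0 => u v w k; nia.
- right; case: H4 => [/(_ i)|]; first by rewrite Hi.
  rewrite (bigD1 j) //= [in X in _ -> X](bigD1 j) //= Hp eqxx.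
  rewrite [\sum_(_ | _) pr' _](eq_bigr pr); last by move=> o' /negPf E; rewrite Hp E.
  by move: (\sum_(_ | _) _) => y; lia.
Qed.

Lemma auction_inv0 : auction_inv 0 (fun=> 0) (fun=> -1) (fun=> -1).
Proof.
split=> [j|i|j|]; [by left | by left | | by right; rewrite big1_eq].
have B0 : 0 <= B by apply: le_trans (normr_ge0 _) (x_le j j).
by rewrite lexx /= addr_ge0 // !mulr_ge0.
Qed.

Lemma auction_inv_ext t pr holder item pr' holder' item' :
  auction_inv t pr holder item -> pr =1 pr' -> holder =1 holder' -> item =1 item' ->
  auction_inv t pr' holder' item'.
Proof.
move=> [H1 H2 H3 H4] Ep Eh Em; split.
- move=> j; case: (H1 j) => [[? ?]|[i [? ? H]]]; [left|right; exists i];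
  rewrite -?Ep -?Eh -?Em.
    by [].
  by split=> // o; rewrite -!Ep.
- by move=> i; case: (H2 i) => [|[j ? ?]]; [left|right; exists j]; rewrite -?Em -?Eh.
- by move=> j; rewrite -Ep.
- by case: H4 => [H|H]; [left=> i; rewrite -Em | right;
  rewrite -(eq_bigr _ (fun i _ => Ep i))].
Qed.

(** The prices sum to at most [N * (2 * B * K + 1)]. Beyond that many steps every bidder holds an
    object, so [item] is a permutation. *)
Lemma auction_done t pr holder item :
  auction_inv t pr holder item -> N%:Z * (2 * B * K + 1) < t%:Z ->
  exists2 s : {perm 'I_N}, (forall i, item i = (s i)%:Z) &
    forall t : {perm 'I_N}, \sum_i x i (t i) <= \sum_i x i (s i).
Proof.
move=> [H1 H2 H3 H4] Ht.
have {}H4 i : 0 <= item i.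
  case: H4 => // H; exfalso;
    suff : t%:Z <= N%:Z * (2 * B * K + 1) by rewrite leNgt Ht.
  apply: le_trans H _; have -> : N%:Z * (2 * B * K + 1) = \sum_(j < N) (2 * B *
    K + 1).
    by rewrite sumr_const card_ord -[N%:Z]natz mulr_natl.
  by apply: ler_sum => j _; case/andP: (H3 j).
have H i : exists j : 'I_N, item i = j%:Z /\ holder j = i%:Z.
  by case: (H2 i) => [E|[j ? ?]]; [move: (H4 i); rewrite E | exists j].
have [f Hf] := fin_all_exists H.
have finj : injective f.
  by move=> i i' E; apply: val_inj; have := (Hf i).2; rewrite E (Hf i').2 => -[].
exists (perm finj) => [i|s]; first by rewrite permE (Hf i).1.
apply: (auction_optimal (q := pr)) => i j; rewrite permE.
case: (H1 (f i)) => [[]|[b []]]; first by rewrite (Hf i).2.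
by rewrite (Hf i).2 => -[/val_inj <-].
Qed.

End AuctionStep.

(** * The program *)

Arguments run : simpl never.
Arguments setx : simpl never.
Arguments ar : simpl never.

Lemma run_seq p q h : run (PSeq p q) h = run q (run p h). Proof. by []. Qed.
Lemma run_skip h : run PSkip h = h. Proof. by []. Qed.
Lemma run_put a i e h :
  run (PPut a i e) h = setx h a (heval (ar h) i) (heval (ar h) e).
Proof. by []. Qed.
Lemma run_if e p q h :
  run (PIf e p q) h = if heval (ar h) e != 0 then run p h else run q h.
Proof. by []. Qed.
Lemma run_ifL e1 e2 p q h : run (PIf (HL e1 e2) p q) h =
  if heval (ar h) e1 <= heval (ar h) e2 then run p h else run q h.
Proof. by rewrite run_if /=; case: (_ <= _). Qed.
Lemma ar_setx h a i x b j :
  ar (setx h a i x) b j = if (b == a) && (j == i) then x else ar h b j.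
Proof. by []. Qed.

Lemma notin_sub (s t : seq nat) a :
  all (fun b => b \in t) s -> a \notin t -> a \notin s.
Proof. by move=> /allP st; apply: contra => /st. Qed.

Ltac step := rewrite ?(run_seq, run_skip, run_put) /= ?ar_setx /= ?eqxx /=.

Lemma bool_neq0 (t : bool) : ((t : nat)%:Z != 0) = t. Proof. by case: t. Qed.

Notation vN := 3%N (only parsing).
Notation vK := 4%N (only parsing).
(* In the auction, vi bids for vj and aPR, aAS, aBD hold the prices, the holders
   and the items of [auction_inv]. *)
Notation aPR := 15%N (only parsing).
Notation aAS := 16%N (only parsing).
Notation aBD := 17%N (only parsing).
Notation vi := 18%N (only parsing).
Notation vj := 19%N (only parsing).
Notation ctr := 24%N (only parsing).
Notation vl := 32%N (only parsing).

Definition setv x e := PPut x (HC 0) e.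

(** * The auction as a program, generic in the expression for the values *)

Section Auction.
Variable val : hexpr -> hexpr -> hexpr.

Definition surplus i o := HM (HT (scal vK) (val i o)) (HG aPR o).

Definition find_free :=
  PFor vl vN (PIf (HL (HG aBD (scal vl)) (HC (-1))) (setv vi (scal vl)) PSkip).

Definition find_best :=
  PFor vl vN (PIf (HL (surplus (scal vi) (scal vl)) (surplus (scal vi) (scal vj)))
                PSkip (setv vj (scal vl))).

Definition assign :=
  pseq [:: PPut aPR (scal vj) (HP (HG aPR (scal vj)) (HC 1));
           PIf (HL (HC 0) (HG aAS (scal vj))) (PPut aBD (HG aAS (scal vj)) (HC
             (-1))) PSkip;
           PPut aAS (scal vj) (scal vi);
           PPut aBD (scal vi) (scal vj)].

Definition bid :=
  pseq [:: setv vi (HC (-1)); find_free;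
    PIf (HL (HC 0) (scal vi)) (pseq [:: setv vj (HC 0); find_best; assign]) PSkip].

(** With B <= N and K = N + 1, at most 2N^3 + 2N^2 + N bids can raise prices, which is less than (N
    + 1)^4; hence four nested loops. *)
Definition auction :=
  pseq [:: PFor vl vN (pseq [:: PPut aPR (scal vl) (HC 0);
    PPut aAS (scal vl) (HC (-1));
                                PPut aBD (scal vl) (HC (-1))]);
           rep ctr vK 4 bid].

Definition auction_writes := [:: 15; 16; 17; 18; 19; 24; 25; 26; 27; 32]%N.

Variables (N : nat) (x : 'I_N -> 'I_N -> int) (B : int) (h0 : hst).
Hypothesis N_gt0 : (0 < N)%N.
Hypothesis x_le : forall i j, `|x i j| <= B.
Hypothesis B_N : B <= N%:Z.
Hypothesis vN_N : ar h0 vN 0 = N%:Z.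
Hypothesis vK_N : ar h0 vK 0 = N.+1%:Z.

Definition framed h := forall a j, a \notin auction_writes -> ar h a j = ar h0 a j.

Hypothesis valP : forall h, framed h -> forall e1 e2 (i j : 'I_N),
  heval (ar h) e1 = i%:Z -> heval (ar h) e2 = j%:Z -> heval (ar h) (val e1 e2)
    = x i j.

Lemma framed_run p h : (forall a, a \notin auction_writes -> a \notin writes p) ->
  framed h -> framed (run p h).
Proof. by move=> Hp fr a j ja; rewrite run_frame ?Hp // fr. Qed.

Lemma framed_setx h y i z : y \in auction_writes -> framed h -> framed (setx h
  y i z).
Proof.
move=> yw fr a j ja; rewrite ar_setx; case: eqP => [E|_] /=; last exact: fr.
by rewrite E yw in ja.
Qed.

Lemma find_freeP h : framed h -> ar h vi 0 = -1 ->
  (forall i : 'I_N, -1 <= ar h aBD i%:Z) ->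
  let h' := run find_free h in
  (ar h' vi 0 = -1 /\ forall i : 'I_N, 0 <= ar h aBD i%:Z) \/
  exists2 i : 'I_N, ar h' vi 0 = i%:Z & ar h aBD i%:Z = -1.
Proof.
move=> fr hi ge; rewrite /find_free.
pose J k h' := (ar h' vi 0 = -1 /\ forall i : 'I_N, (i < k)%N -> 0 <= ar h aBD
  i%:Z) \/
  exists2 i : 'I_N, ar h' vi 0 = i%:Z & ar h aBD i%:Z = -1.
suff : J N (run find_free h).
  by case=> [[E H]|H]; [left; split=> // i; apply: H | right].
apply: run_for => //; first by rewrite fr.
  by left; step.
move=> k h1 kN hl fr1 IH; rewrite /J run_if /= bool_neq0 hl.
rewrite (fr1 aBD) //; case: ifP => Hk; step; rewrite ?hl.
  right; exists (Ordinal kN) => //.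
  by apply: le_anti; rewrite Hk (ge (Ordinal kN)).
case: IH => [[E H]|H]; [left|by right]; split=> // i; rewrite ltnS leq_eqVlt.
by case/orP => [/eqP ->|]; [move: Hk; lia | apply: H].
Qed.

Lemma surplusP h e1 e2 (i j : 'I_N) : framed h ->
  heval (ar h) e1 = i%:Z -> heval (ar h) e2 = j%:Z ->
  heval (ar h) (surplus e1 e2) = N.+1%:Z * x i j - ar h aPR j%:Z.
Proof. by move=> fr E1 E2 /=; rewrite (valP fr E1 E2) E2 fr // vK_N. Qed.

Lemma find_bestP h (i : 'I_N) : framed h -> ar h vi 0 = i%:Z -> ar h vj 0 = 0 ->
  exists2 j : 'I_N, ar (run find_best h) vj 0 = j%:Z &
    best_for x (fun o => ar h aPR o%:Z) i j.
Proof.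
move=> fr hi hj; rewrite /find_best.
pose J k h' := exists2 j : 'I_N, ar h' vj 0 = j%:Z &
  forall o : 'I_N, (o < k)%N -> N.+1%:Z * x i o - ar h aPR o%:Z <=
     N.+1%:Z * x i j - ar h aPR j%:Z.
suff : J N (run find_best h) by case=> j E H; exists j => // o; apply: H.
apply: run_for => //; first by rewrite fr.
  by exists (Ordinal N_gt0) => //; step.
move=> k h1 kN hl fr1 [j Ej IH]; rewrite /J run_ifL.
have fr' : framed h1.
  move=> a z aw; rewrite fr1 ?fr //; apply: contra aw.
  by rewrite !inE => /orP[] /eqP ->.
have E1 : heval (ar h1) (scal vi) = i%:Z by rewrite /= fr1.
have El : heval (ar h1) (scal vl) = (Ordinal kN)%:Z by rewrite /= hl.
have Ev : heval (ar h1) (scal vj) = j%:Z by [].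
rewrite (surplusP fr' E1 El) (surplusP fr' E1 Ev) !(fr1 aPR) //.
case: ifP => Hk; step.
  exists j => // o; rewrite ltnS leq_eqVlt => /orP[/eqP E|]; last exact: IH.
  by have -> : o = Ordinal kN by apply: val_inj.
exists (Ordinal kN); first by rewrite hl.
move=> o; rewrite ltnS leq_eqVlt => /orP[/eqP E|/IH]; last by move: Hk; lia.
by have -> : o = Ordinal kN by apply: val_inj.
Qed.

Lemma assignP h (i j : 'I_N) : ar h vi 0 = i%:Z -> ar h vj 0 = j%:Z ->
  -1 <= ar h aAS j%:Z ->
  let h' := run assign h in
  [/\ forall o : 'I_N, ar h' aPR o%:Z = if o == j then ar h aPR o%:Z + 1 else
    ar h aPR o%:Z,
      forall o : 'I_N, ar h' aAS o%:Z = if o == j then i%:Z else ar h aAS o%:Z &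
      forall b : 'I_N, ar h' aBD b%:Z =
        if b == i then j%:Z else if ar h aAS j%:Z == b%:Z then -1 else ar h aBD
          b%:Z].
Proof.
move=> hi hj ge /=; rewrite /assign /pseq /=; step.
rewrite !run_if /= !ar_setx /= ?hi hj bool_neq0.
case: ifP => H; step; rewrite ?hi ?hj; split=> [o|o|b];
  rewrite !ar_setx /= ?hi ?hj ?eqz_nat //.
- by rewrite -(inj_eq val_inj) /=; case: eqP => [->|].
- by rewrite -(inj_eq val_inj) /=; case: eqP => // _; rewrite eq_sym.
- by rewrite -(inj_eq val_inj) /=; case: eqP => [->|].
- rewrite -(inj_eq val_inj) /=; case: eqP => // _; case: eqP => // E;
  by rewrite E in H.
Qed.

Definition inv_state t h := framed h /\
  auction_inv x B t (fun j => ar h aPR j%:Z) (fun j => ar h aAS j%:Z) (fun i =>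
    ar h aBD i%:Z).

Lemma bid_step t h : inv_state t h -> inv_state t.+1 (run bid h).
Proof.
move=> [fr inv]; have [I1 I2 _ _] := inv; split.
  apply: framed_run fr => a; exact: notin_sub.
rewrite /bid /pseq /= run_seq; set h1 := run (setv vi _) h.
have fr1 : framed h1 by apply: framed_setx.
have E1 : ar h1 vi 0 = -1 by rewrite /h1 /setv; step.
have F1 b j : b != vi -> ar h1 b j = ar h b j.
  by move=> bi; rewrite /h1 /setv; step; rewrite (negPf bi).
rewrite run_seq; set h2 := run find_free h1.
have fr2 : framed h2.
  apply: framed_run fr1 => a; exact: notin_sub.
have F2 b j : b != vi -> b != vl -> ar h2 b j = ar h b j.
  by move=> bi bl; rewrite /h2 run_frame ?F1 // !inE !negb_or bi bl.
have [|[E2 all0]|[i E2 free]] := find_freeP fr1 E1.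
- by move=> i; rewrite F1 //; case: (I2 i) => [->|[j ->]].
(* No bidder is free: the assignment stays and only [t] advances, as the last clause of the
   invariant permits. *)
- rewrite !run_seq run_if /= E2 /= !run_skip.
  apply: (@auction_inv_ext _ _ _ t.+1 (fun j => ar h aPR j%:Z) (fun j => ar h
    aAS j%:Z) (fun i => ar h aBD i%:Z)).
  + by case: inv => ? ? ? _; split=> //; left=> i; have := all0 i; rewrite F1.
  + by move=> j /=; rewrite F2.
  + by move=> j /=; rewrite F2.
  + by move=> j /=; rewrite F2.
rewrite !run_seq run_if /= E2 /= !run_skip run_seq.
set h3 := run (setv vj _) h2.
have fr3 : framed h3 by apply: framed_setx.
have E3 : ar h3 vj 0 = 0 by rewrite /h3 /setv; step.
have F3 b j : b != vi -> b != vl -> b != vj -> ar h3 b j = ar h b j.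
  by move=> bi bl bj; rewrite /h3 /setv; step; rewrite (negPf bj) F2.
have E3i : ar h3 vi 0 = i%:Z by rewrite /h3 /setv; step.
have [j Ej best] := find_bestP fr3 E3i E3.
rewrite run_seq; set h4 := run find_best h3 in Ej *.
have F4 b z : b != vi -> b != vl -> b != vj -> ar h4 b z = ar h b z.
  by move=> bi bl bj; rewrite /h4 run_frame ?F3 // !inE !negb_or bl bj.
have E4i : ar h4 vi 0 = i%:Z by rewrite /h4 run_frame.
have [|P1 P2 P3] := assignP E4i Ej.
  by rewrite F4 //; case: (I1 j) => [[-> _]|[b [-> _ _]]].
rewrite run_seq run_skip.
apply: (auction_stepP (i := i) (j := j) x_le inv).
- by move: free; rewrite F1.
- by move=> o; have := best o; rewrite !F3.
- by move=> o; rewrite P1 F4.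
- by move=> o; rewrite P2 F4.
- by move=> b; rewrite P3 !F4.
Qed.

Lemma auctionP :
  let h' := run auction h0 in
  exists2 s : {perm 'I_N}, (forall i : 'I_N, ar h' aBD i%:Z = (s i)%:Z) &
    forall t : {perm 'I_N}, \sum_i x i (t i) <= \sum_i x i (s i).
Proof.
rewrite /auction /pseq /= run_seq; set h1 := run (PFor _ _ _) h0.
have fr1 : framed h1.
  apply: framed_run => // a; exact: notin_sub.
have init (i : 'I_N) : [/\ 0 = ar h1 aPR i%:Z, -1 = ar h1 aAS i%:Z & -1 = ar h1
  aBD i%:Z].
  pose J k h' := forall i : 'I_N, (i < k)%N ->
    [/\ 0 = ar h' aPR i%:Z, -1 = ar h' aAS i%:Z & -1 = ar h' aBD i%:Z].
  suff H : J N h1 by apply: H.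
  apply: run_for => // k h' kN hl _ IH {}i; rewrite ltnS leq_eqVlt /pseq /=; step.
  by rewrite hl eqz_nat; case: eqP => //= _ /IH.
have inv1 : inv_state 0 h1.
  by split=> //; apply: (auction_inv_ext (auction_inv0 x_le)) => i; case: (init i).
rewrite run_seq run_skip.
have : inv_state (0 + N.+1 ^ 4) (run (rep ctr vK 4 bid) h1).
  apply: run_rep inv1.
  - move=> y v h t yr [fr inv]; split.
      by apply: framed_setx fr; move: yr; rewrite !inE; lia.
    by apply: auction_inv_ext inv _ _ _ => j /=; rewrite ar_setx;
      case: eqP => // E; lia.
  - by move=> t h; apply: bid_step.
  - by move=> t h [fr _]; rewrite fr.
case=> _ /auction_done; apply => //.
have B0 : 0 <= B by apply: le_trans (normr_ge0 _) (x_le (Ordinal N_gt0)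
  (Ordinal N_gt0)).
rewrite add0n -[(_ ^ 4)%N%:Z]natz natrX [N.+1%:R]natz.
have -> : N.+1%:Z = N%:Z + 1 by lia.
have : 1 <= N%:Z by lia.
move: (N%:Z) B_N B0 => M BM B0 M1.
have h1' : M * (B * (M + 1)) <= M * (M * (M + 1)).
  by apply: ler_wpM2l; [lia | apply: ler_wpM2r; lia].
have h2' : 0 <= M * M by nia.
have h3' : 0 <= M * M * M by nia.
have h4' : M * M <= M * M * M * M by nia.
nra.
Qed.

End Auction.

(* vn, vm, vN, vK hold the number of points n, the target, the number n + k of
   nodes and n + k + 1; aRN, aRD, aDN, aDD the numerators and denominators of
   the radii and distances; vcv, vcs the current candidate (v0, s0); aC, aOWN,
   aW the scores, the capturing points (-1 for none) and the weights. *)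
Notation vn := 1%N (only parsing).
Notation vm := 2%N (only parsing).
Notation aRN := 5%N (only parsing).
Notation aRD := 6%N (only parsing).
Notation aDN := 7%N (only parsing).
Notation aDD := 8%N (only parsing).
Notation vcv := 9%N (only parsing).
Notation vcs := 10%N (only parsing).
Notation aC := 11%N (only parsing).
Notation aOWN := 12%N (only parsing).
Notation aW := 13%N (only parsing).
Notation vp := 14%N (only parsing).
Notation vFOUND := 21%N (only parsing).
Notation vBAD := 22%N (only parsing).
Notation vCNT := 23%N (only parsing).
Notation vt := 31%N (only parsing).
Notation vq := 33%N (only parsing).

(** * Tests on rational data by integer arithmetic *)

Definition lt_e e1 e2 := HL (HP e1 (HC 1)) e2.
Definition not_e e := HM (HC 1) e.

Definition dn u v := HG aDN (HP (HT u (scal vn)) v).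
Definition dd u v := HG aDD (HP (HT u (scal vn)) v).

Definition half_e p v :=
  HL (HT (HG aRN p) (HG aRD v)) (HT (HC 2) (HT (HG aRN v) (HG aRD p))).

(** The inequality for the ratio of the current candidate, with denominators cleared. Products are
    harmless here: the result only enters tests and is never stored. *)
Definition near_e p v :=
  HL (HT (HT (dn p v) (HT (HG aRN (scal vcv)) (dd (scal vcv) (scal vcs))))
         (HT (HG aRD p) (HG aRD v)))
     (HT (HT (dn (scal vcv) (scal vcs)) (HG aRD (scal vcv)))
         (HT (HP (HT (HG aRN p) (HG aRD v)) (HT (HG aRN v) (HG aRD p))) (dd p v))).

(** Truth values are 0 and 1, and products are conjunctions. A successor is allowed if it is
    auxiliary or reached by an edge. *)
Definition allowed_e i j :=
  not_e (HT (lt_e j (scal vn)) (not_e (HT (near_e i j) (not_e (half_e i j))))).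

Definition gain_e i j :=
  HT (lt_e i (scal vn))
    (HT (not_e (HT (HL i j) (HL j i)))
       (HM (HT (allowed_e i j) (HG aW i)) (HT (not_e (allowed_e i j)) (scal vn)))).

Record loaded (I : instance) (h : hst) : Prop := Loaded {
  loaded_n : ar h vn 0 = (npts I)%:Z;
  loaded_RN : forall v : 'I_(npts I), ar h aRN v%:Z = numq (radius v);
  loaded_RD : forall v : 'I_(npts I), ar h aRD v%:Z = denq (radius v);
  loaded_DN : forall u v : 'I_(npts I),
    ar h aDN (u%:Z * (npts I)%:Z + v%:Z) = numq (dist u v);
  loaded_DD : forall u v : 'I_(npts I),
    ar h aDD (u%:Z * (npts I)%:Z + v%:Z) = denq (dist u v) }.

Lemma loaded_eq (I : instance) h h' : (forall a j, a \in [:: 1; 5; 6; 7;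
  8]%N -> ar h' a j = ar h a j) ->
  loaded I h -> loaded I h'.
Proof. by move=> E [? ? ? ? ?]; split=> *; rewrite E. Qed.

Lemma ltz_bool (i j : int) : ((i + 1 <= j)%R : bool) = (i < j). Proof. by
  rewrite -ltzD1 ltrD2r. Qed.

Lemma not_bool (b : bool) : 1 - (b : nat)%:Z = (~~ b : nat)%:Z. Proof. by case:
  b. Qed.

Lemma and_bool (b c : bool) : (b : nat)%:Z * (c : nat)%:Z = (b && c : nat)%:Z.
Proof. by case: b; case: c. Qed.

Section Test.
Variables (I : instance) (v0 s0 : 'I_(npts I)) (k : nat).
Local Notation n := (npts I).
Let a := dist v0 s0 / radius v0.

Definition candidate h := ar h vcv 0 = v0%:Z /\ ar h vcs 0 = s0%:Z.

Lemma ratio_ge0 : 0 <= a.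
Proof. by rewrite divr_ge0 ?dist_ge0 // ltW // radius_gt0. Qed.

Lemma half_eP h e1 e2 (p v : 'I_n) : loaded I h ->
  heval (ar h) e1 = p%:Z -> heval (ar h) e2 = v%:Z ->
  heval (ar h) (half_e e1 e2) = (half p v : nat)%:Z.
Proof.
move=> L /= -> ->; rewrite !(loaded_RN L) !(loaded_RD L); congr (nat_of_bool _)%:Z.
rewrite -(ler_int rat) !rmorphM /= !numqE /half.
have Pp : 0 < (denq (radius p))%:~R :> rat by rewrite ltr0z denq_gt0.
have Pv : 0 < (denq (radius v))%:~R :> rat by rewrite ltr0z denq_gt0.
rewrite -[RHS](ler_pM2r (mulr_gt0 Pp Pv)); congr (_ <= _); ring.
Qed.

Lemma near_eP h e1 e2 (p v : 'I_n) : loaded I h -> candidate h ->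
  heval (ar h) e1 = p%:Z -> heval (ar h) e2 = v%:Z ->
  heval (ar h) (near_e e1 e2) = (near a p v : nat)%:Z.
Proof.
move=> L [Ev Es] /= -> ->; rewrite Ev Es !(loaded_n L).
rewrite !(loaded_RN L) !(loaded_RD L) !(loaded_DN L) !(loaded_DD L);
  congr (nat_of_bool _)%:Z.
rewrite -(ler_int rat) !(rmorphM, rmorphD) /= ?rmorphM /= !numqE /near.
have P q : 0 < (denq q)%:~R :> rat by rewrite ltr0z denq_gt0.
have -> : (dist p v <= a * (radius p + radius v)) =
    (dist p v * radius v0 <= dist v0 s0 * (radius p + radius v)).
  by rewrite /a mulrAC ler_pdivlMr ?radius_gt0.
(* The common denominator by which [near_e] is multiplied. *)
have PP := mulr_gt0 (mulr_gt0 (mulr_gt0 (P (dist p v)) (P (radius v0)))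
  (mulr_gt0 (P (radius p)) (P (radius v)))) (P (dist v0 s0)).
rewrite -[RHS](ler_pM2r PP); congr (_ <= _); ring.
Qed.

Definition wt h (u : 'I_n) : int := ar h aW u%:Z.

(** For auxiliary nodes the expression reads cells outside the tables; the factors [lt_e] annihilate
    whatever they contain. *)
Lemma gain_eP h e1 e2 (i j : 'I_(n + k)) : loaded I h -> candidate h ->
  heval (ar h) e1 = i%:Z -> heval (ar h) e2 = j%:Z ->
  heval (ar h) (gain_e e1 e2) = gain a (wt h) i j.
Proof.
move=> L cd E1 E2.
have ltE (z : 'I_(n + k)) e : heval (ar h) e = z%:Z ->
    heval (ar h) (lt_e e (scal vn)) = ((z < n)%N : nat)%:Z.
  by move=> /= ->; rewrite (loaded_n L) ltz_bool ltz_nat.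
rewrite -[LHS]/(heval (ar h) (lt_e e1 (scal vn)) *
  ((1 - ((heval (ar h) e1 <= heval (ar h) e2)%R%:Z * (heval (ar h) e2 <= heval
    (ar h) e1)%R%:Z)) *
   ((heval (ar h) (allowed_e e1 e2)) * ar h aW (heval (ar h) e1) -
    (1 - heval (ar h) (allowed_e e1 e2)) * ar h vn 0))).
rewrite (ltE i) // E1 E2 and_bool not_bool !lez_nat -eqn_leq (loaded_n L).
rewrite /gain; case: (splitP i) => [u Eu|z Ez]; last first.
  by rewrite mul0r.
rewrite Eu mul1r.
have -> : heval (ar h) (allowed_e e1 e2) =
   1 - ((j < n)%N : nat)%:Z * (1 - heval (ar h) (near_e e1 e2) * (1 - heval (ar
     h) (half_e e1 e2))).
  by rewrite -(ltE j e2).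
case: (splitP j) => [v Ejv|z Ejz].
  rewrite Ejv (near_eP (p := u) (v := v)) ?(half_eP (p := u) (v := v)) // ?E1
    ?E2 ?Eu ?Ejv //.
  rewrite !(not_bool, and_bool) /= negbK -/(edge a u v) -(inj_eq val_inj) /=.
  by case: eqP => _; [rewrite mul0r | rewrite mul1r; case: (edge a u v);
    rewrite /wt; lia].
rewrite Ejz !mul0r !subr0 mul1r.
have -> : (u == n + z :> nat)%N = false by apply/eqP => E; have := ltn_ord u;
  rewrite E; lia.
by rewrite mul1r.
Qed.

(** * Filtering *)

(** [ow v] is the capturing point of [v], or -1. The second clause, that a capturing point leaves
    nothing it could capture, is what yields the separation in the third. The last one measures
    progress. *)
Definition filter_inv (c : 'I_n -> int) t (ow : 'I_n -> int) :=
  [/\ forall v, ow v = -1 \/ exists p : 'I_n, [/\ ow v = p%:Z, captures a p v &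
    c v <= c p],
      forall v (q u : 'I_n), ow v = q%:Z -> captures a q u -> 0 <= ow u,
      forall v v' (q q' : 'I_n), ow v = q%:Z -> ow v' = q'%:Z -> q != q' ->
        ~~ captures a q q' || ~~ captures a q' q &
      (forall v, 0 <= ow v) \/ (t <= #|[set v | (0 <= ow v)%R]|)%N].

Lemma captures_refl (p : 'I_n) : captures a p p.
Proof.
rewrite /captures half_refl /near (dist_eq0 p p).2 // mulr_ge0 ?ratio_ge0 //.
by rewrite addr_ge0 // ltW // radius_gt0.
Qed.

(** The new point [p] was uncaptured, so no earlier capturing point captures it: this separates [p]
    from all of them. As [p] captures itself, the number of captured points increases. *)
Lemma filter_inv_step c t ow ow' (p : 'I_n) :
  filter_inv c t ow -> ow p = -1 -> (forall v, ow v = -1 -> c v <= c p) ->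
  (forall v, ow' v = if (ow v == -1) && captures a p v then p%:Z else ow v) ->
  filter_inv c t.+1 ow'.
Proof.
move=> [H1 H2 H3 H4] op cp Hw.
have old v : ow v = -1 \/ exists q : 'I_n, ow v = q%:Z /\ ow' v = q%:Z.
  case: (H1 v) => [|[q [E _ _]]]; first by left.
  by right; exists q; rewrite Hw E.
have ge v : 0 <= ow v -> 0 <= ow' v by rewrite Hw; case: ifP.
have inv v (q : 'I_n) : ow' v = q%:Z -> (q = p /\ ow v = -1) \/ ow v = q%:Z.
  by rewrite Hw; case: ifP => [/andP[/eqP -> _] [/val_inj ->]|_ ->]; [left|right].
split.
- move=> v; rewrite Hw; case: eqP => [Ev|ne] /=; last by case: (H1 v).
  by case: ifP => cv; [right; exists p; split=> //; apply: cp | left].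
- move=> v q u /inv[[-> _]|E] cq; last exact: ge (H2 _ _ _ E cq).
  rewrite Hw cq andbT; case: eqP => // ne.
  by case: (H1 u) => [//|[x [-> _ _]]].
- move=> v v' q q' /inv[[-> _]|E] /inv[[-> _]|E'] qq.
  + by rewrite eqxx in qq.
  + by apply/orP; right; apply/negP => /(H2 _ _ _ E'); rewrite op.
  + by apply/orP; left; apply/negP => /(H2 _ _ _ E); rewrite op.
  + exact: H3 E E' qq.
right; case: H4 => [/(_ p)|H4]; first by rewrite op.
apply: leq_ltn_trans H4 _; apply: proper_card; apply/properP; split.
  by apply/subsetP => v; rewrite !inE; apply: ge.
by exists p; rewrite !inE ?op // Hw op eqxx captures_refl.
Qed.

(** Once all points are captured, further rounds are idle and the count [t] is arbitrary. *)
Lemma filter_inv_done c t t' ow ow' :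
  filter_inv c t ow -> (forall v, 0 <= ow v) -> ow =1 ow' -> filter_inv c t' ow'.
Proof.
move=> [H1 H2 H3 _] all0 E; split=> [v|v q u|v v' q q'|]; rewrite -?E.
- exact: H1.
- exact: H2.
- exact: H3.
- by left=> v; rewrite -E.
Qed.

Definition select :=
  PFor vq vn
    (PIf (HT (HL (HG aOWN (scal vq)) (HC (-1)))
             (not_e (HT (HL (HC 0) (scal vp)) (HL (HG aC (scal vq)) (HG aC
               (scal vp))))))
       (setv vp (scal vq)) PSkip).

Definition capture :=
  PFor vq vn
    (PIf (HT (HL (HG aOWN (scal vq)) (HC (-1)))
             (HT (half_e (scal vp) (scal vq)) (near_e (scal vp) (scal vq))))
       (PPut aOWN (scal vq) (scal vp)) PSkip).

Definition round :=
  pseq [:: setv vp (HC (-1)); select; PIf (HL (HC 0) (scal vp)) capture PSkip].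

Definition filter_prog :=
  pseq [:: PFor vq vn (pseq [:: PPut aOWN (scal vq) (HC (-1));
    PPut aW (scal vq) (HC 0)]);
           PFor vt vn round;
           PFor vq vn (PPut aW (HG aOWN (scal vq)) (HP (HG aW (HG aOWN (scal
             vq))) (HC 1)))].

Lemma selectP h : loaded I h -> ar h vp 0 = -1 ->
  (forall v : 'I_n, -1 <= ar h aOWN v%:Z) ->
  let h' := run select h in
  (ar h' vp 0 = -1 /\ forall v : 'I_n, 0 <= ar h aOWN v%:Z) \/
  exists p : 'I_n, [/\ ar h' vp 0 = p%:Z, ar h aOWN p%:Z = -1 &
    forall v : 'I_n, ar h aOWN v%:Z = -1 -> ar h aC v%:Z <= ar h aC p%:Z].
Proof.
move=> L hp ge; rewrite /select.
pose J i h' := (ar h' vp 0 = -1 /\ forall v : 'I_n, (v < i)%N -> 0 <= ar h aOWN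
  v%:Z) \/
  exists p : 'I_n, [/\ ar h' vp 0 = p%:Z, ar h aOWN p%:Z = -1 &
    forall v : 'I_n, (v < i)%N -> ar h aOWN v%:Z = -1 -> ar h aC v%:Z <= ar h
      aC p%:Z].
suff : J n (run select h).
  case=> [[E H]|[p [E1 E2 H]]]; [left; split=> // v; exact: H | right;
    exists p; split=> // v].
  exact: H.
apply: run_for => //; first exact: loaded_n L.
  by left; step.
move=> i h1 iN hl fr IH;
  rewrite /J run_if /= hl !(fr aOWN) // !(fr aC) // and_bool not_bool and_bool
    bool_neq0.
pose o := Ordinal iN.
have last_or (v : 'I_n) : (v < i.+1)%N -> v = o \/ (v < i)%N.
  by rewrite ltnS leq_eqVlt => /orP[/eqP E|]; [left; apply: val_inj | right].
case: ifP => [/andP[Ho Hc]|Hn]; step; rewrite ?hl.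
  have Eo : ar h aOWN o%:Z = -1 by apply: le_anti; rewrite Ho (ge o).
  right; exists o; split=> // v /last_or[->//|vi] Ev.
  case: IH => [[_ /(_ v vi)]|[p [Ep Op H]]]; first by rewrite Ev.
  by apply: le_trans (H v vi Ev) _; move: Hc; rewrite Ep /= -ltNge => /ltW.
have [Ho|Ho] := leP 0 (ar h aOWN o%:Z).
  case: IH => [[E H]|[p [E1 E2 H]]]; [left|right; exists p];
    split=> // v /last_or[->//|vi].
  - exact: H.
  - by move=> Ev; rewrite Ev in Ho.
  - exact: H.
have Ho' : ar h aOWN o%:Z <= -1 by move: Ho; lia.
move: Hn; rewrite Ho' /= => /negbFE/andP[p0 cle].
case: IH => [[E H]|[p [E1 E2 H]]]; first by rewrite E in p0.
right; exists p; split=> // v /last_or[->|vi]; last exact: H.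
by move=> _; rewrite E1 in cle.
Qed.

Lemma captureP h (p : 'I_n) : loaded I h -> candidate h -> ar h vp 0 = p%:Z ->
  (forall v : 'I_n, -1 <= ar h aOWN v%:Z) ->
  let h' := run capture h in
  forall v : 'I_n, ar h' aOWN v%:Z =
    if (ar h aOWN v%:Z == -1) && captures a p v then p%:Z else ar h aOWN v%:Z.
Proof.
move=> L cd hp ge /=; rewrite /capture.
pose J i h' := forall v : 'I_n, ar h' aOWN v%:Z =
    if (v < i)%N && ((ar h aOWN v%:Z == -1) && captures a p v) then p%:Z else
      ar h aOWN v%:Z.
suff H : J n (run capture h) by rewrite -[PFor _ _ _]/capture => v;
  rewrite H ltn_ord.
apply: run_for => //; first exact: loaded_n L.
move=> i h1 iN hl fr IH v; pose o := Ordinal iN.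
have L1 : loaded I h1.
  by apply: loaded_eq L => b j; rewrite !inE => /or4P[| | |/orP[]] /eqP ->;
    rewrite fr.
have cd1 : candidate h1 by case: cd => [? ?]; split; rewrite fr.
have Ep : heval (ar h1) (scal vp) = p%:Z by rewrite /= fr.
have El : heval (ar h1) (scal vq) = o%:Z by rewrite /= hl.
rewrite run_if -[heval _ _]/((heval (ar h1) (HL (HG aOWN (scal vq)) (HC (-1)))) *
  (heval (ar h1) (half_e (scal vp) (scal vq)) * heval (ar h1) (near_e (scal vp)
    (scal vq)))).
rewrite (half_eP L1 Ep El) (near_eP L1 cd1 Ep El) /= hl (IH o) /= ltnn /=
  !and_bool bool_neq0 -/(captures _ _ _).
have -> : (ar h aOWN i%:Z <= -1) = (ar h aOWN o%:Z == -1).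
  by rewrite eq_le (ge o) andbT.
rewrite ltnS leq_eqVlt.
case: ifP => H; step; rewrite ?hl IH.
  rewrite eqz_nat; case: (eqVneq (nat_of_ord v) i) => [E|_] //=.
  by have -> : v = o; [apply: val_inj | rewrite H fr].
case: (eqVneq (nat_of_ord v) i) => [E|_] //=.
by have -> : v = o; [apply: val_inj | rewrite H ltnn].
Qed.

Lemma card_ltS (P : pred 'I_n) (i : 'I_n) :
  #|[set v : 'I_n | (v < i.+1)%N && P v]| = (#|[set v : 'I_n | (v < i)%N && P
    v]| + P i)%N.
Proof.
rewrite (cardsD1 i) inE leqnn /= addnC; congr (_ + _)%N; apply: eq_card => v.
by rewrite !inE [(v < i)%N]ltn_neqAle -ltnS andbA -(inj_eq val_inj).
Qed.

Definition filter_writes := [:: 12; 13; 14; 31; 33]%N.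

Lemma filter_progP h : loaded I h -> candidate h ->
  let h' := run filter_prog h in
  exists own : 'I_n -> 'I_n,
  [/\ forall v : 'I_n, ar h' aOWN v%:Z = (own v)%:Z,
      forall u : 'I_n, ar h' aW u%:Z = #|[set v | own v == u]|%:Z,
      forall v : 'I_n, ar h aC v%:Z <= ar h aC (own v)%:Z,
      forall v, captures a (own v) v &
      forall u v, (exists x, own x = u) -> (exists x, own x = v) -> u != v ->
        ~~ captures a u v || ~~ captures a v u].
Proof.
move=> L cd; rewrite /filter_prog /pseq /= run_seq.
pose c (v : 'I_n) := ar h aC v%:Z.
set h1 := run (PFor _ _ _) h.
have fr1 b j : b \notin filter_writes -> ar h1 b j = ar h b j.
  by move=> bf; rewrite /h1 run_frame //; apply: notin_sub bf.
have init (v : 'I_n) : ar h1 aOWN v%:Z = -1 /\ ar h1 aW v%:Z = 0.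
  pose J i h' := forall v : 'I_n, (v < i)%N -> ar h' aOWN v%:Z = -1 /\ ar h' aW
    v%:Z = 0.
  suff H : J n h1 by apply: H.
  apply: run_for => //; first exact: loaded_n L.
  move=> i h' iN hl _ IH {}v; rewrite ltnS leq_eqVlt /=; step.
  by rewrite hl eqz_nat; case: eqP => //= _ /IH.
rewrite !run_seq run_skip; set h2 := run (PFor vt vn round) h1.
have fr2 b j : b \notin filter_writes -> ar h2 b j = ar h b j.
  by move=> bf; rewrite /h2 run_frame ?fr1 //; apply: notin_sub bf.
have [inv2 W2] : filter_inv c n (fun v => ar h2 aOWN v%:Z) /\ forall v : 'I_n,
  ar h2 aW v%:Z = 0.
  pose J i h' := filter_inv c i (fun v => ar h' aOWN v%:Z) /\ forall v : 'I_n,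
    ar h' aW v%:Z = 0.
  suff : J n h2 by [].
  apply: run_for => //; first by rewrite fr1 //; exact: loaded_n L.
    split=> [|v]; last by step; case: (init v).
    split=> [v|v q u|v v' q q'|]; rewrite ?ar_setx /=; last by right.
    + by left; case: (init v).
    + by case: (init v) => ->.
    + by case: (init v) => ->.
  move=> i h' iN hl fr [inv W0].
  have fr' b j : b \notin filter_writes -> ar h' b j = ar h b j.
    by move=> bf; rewrite fr ?fr1 //; apply: notin_sub bf.
  have L' : loaded I h'.
    by apply: loaded_eq L => b j; rewrite !inE => /or4P[| | |/orP[]] /eqP ->;
      rewrite fr'.
  have cd' : candidate h' by case: cd => [? ?]; split; rewrite fr'.
  have [I1 _ _ _] := inv.
  rewrite /round /pseq /= !run_seq run_skip; set h3 := run (setv _ _) h'.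
  have fr3 b j : b != vp -> ar h3 b j = ar h' b j.
    by move=> bp; rewrite /h3 /setv; step; rewrite (negPf bp).
  have L3 : loaded I h3.
    by apply: loaded_eq L' => b j; rewrite !inE => /or4P[| | |/orP[]] /eqP ->;
      rewrite fr3.
  have cd3 : candidate h3 by case: cd' => [? ?]; split; rewrite fr3.
  have ge (v : 'I_n) : -1 <= ar h3 aOWN v%:Z.
    by rewrite fr3 //; case: (I1 v) => [->|[p [-> _ _]]].
  have E3 : ar h3 vp 0 = -1 by rewrite /h3 /setv; step.
  have S := selectP L3 E3 ge; set h4 := run select h3 in S *.
  have fr4 b j : b != vp -> b != vq -> ar h4 b j = ar h' b j.
    by move=> bp bq; rewrite /h4 run_frame ?fr3 // !inE !negb_or bp bq.
  split; last first.
    by move=> v; rewrite ar_setx /= run_frame ?fr4 //= run_if; case: ifP.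
  case: S => [[E4 all0]|[p [E4 Op best]]].
    rewrite run_if /= E4 /= run_skip.
    apply: filter_inv_done inv _ _ => v; first by have := all0 v; rewrite fr3.
    by rewrite ar_setx /= fr4.
  rewrite run_if /= E4 /=.
  have L4 : loaded I h4.
    by apply: loaded_eq L' => b j; rewrite !inE => /or4P[| | |/orP[]] /eqP ->;
      rewrite fr4.
  have cd4 : candidate h4 by case: cd' => [? ?]; split; rewrite fr4.
  have ge4 (v : 'I_n) : -1 <= ar h4 aOWN v%:Z by rewrite fr4 // -fr3.
  have C4 := captureP L4 cd4 E4 ge4.
  apply: (filter_inv_step (p := p) inv).
  - by rewrite -fr3.
  - by move=> v Ev; have := best v; rewrite !fr3 // Ev !fr' //; apply.
  - by move=> v; rewrite ar_setx /= C4 fr4.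
have L2 : loaded I h2.
  by apply: loaded_eq L => b j; rewrite !inE => /or4P[| | |/orP[]] /eqP ->;
    rewrite fr2.
have [I1 I2 I3 I4] := inv2.
have all0 (v : 'I_n) : 0 <= ar h2 aOWN v%:Z.
  case: I4 => [//|nc].
  have : [set v : 'I_n | 0 <= ar h2 aOWN v%:Z] == [set: 'I_n].
    by rewrite eqEcard subsetT cardsT card_ord.
  by move/eqP/setP/(_ v); rewrite !inE.
have ex (v : 'I_n) : exists p : 'I_n, [/\ ar h2 aOWN v%:Z = p%:Z, captures a p
  v & c v <= c p].
  by case: (I1 v) => // E; have := all0 v; rewrite E.
have [own Hown] := fin_all_exists ex.
set h3 := run _ h2.
have E3 (v : 'I_n) : ar h3 aOWN v%:Z = (own v)%:Z.
  by rewrite /h3 run_frame //; have [-> _ _] := Hown v.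
exists own; split=> //.
- pose J i h' := forall u : 'I_n, ar h' aW u%:Z = #|[set v : 'I_n | (v < i)%N
  && (own v == u)]|%:Z.
  suff H : J n h3.
    by move=> u; rewrite H; congr _%:Z; apply: eq_card => v; rewrite !inE ltn_ord.
  apply: run_for => //; first exact: loaded_n L2.
    move=> u; step; rewrite W2; symmetry; apply/eqP; rewrite eqz_nat cards_eq0.
    by apply/eqP/setP => v; rewrite !inE.
  move=> i h' iN hl fr IH u; step; rewrite hl fr //.
  have [-> _ _] := Hown (Ordinal iN).
  rewrite (card_ltS (fun v => own v == u) (Ordinal iN)) PoszD -IH eqz_nat
    -(inj_eq val_inj) /= eq_sym.
  by case: eqVneq => [E|_] /=; rewrite ?E ?addr0.
- by move=> v; have [_ _] := Hown v.
- by move=> v; have [_] := Hown v.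
move=> u v [x <-] [y <-]; have [Ex _ _] := Hown x; have [Ey _ _] := Hown y.
exact: I3 Ex Ey.
Qed.

End Test.

(** * One attempt, and the test of one candidate dilation *)

Definition scan_bad :=
  PFor vq vN (PIf (HL (gain_e (scal vq) (HG aBD (scal vq))) (HC (-1)))
                (setv vBAD (HC 1)) PSkip).

(** The difference in the condition is nonzero exactly when the capturing point is moved by the
    assignment. *)
Definition scan_count :=
  PFor vq vn (PIf (HM (HG aBD (HG aOWN (scal vq))) (HG aOWN (scal vq)))
                (setv vCNT (HP (scal vCNT) (HC 1))) PSkip).

Definition update_c :=
  PFor vq vn (PPut aC (scal vq) (HP (HG aC (scal vq)) (HM (HC 1) (HG aW (scal
    vq))))).

(** After a success the remaining repetitions do nothing, so the successful assignment survives in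
    [aBD]. *)
Definition attempt :=
  PIf (HL (scal vFOUND) (HC 0))
    (pseq [:: filter_prog; auction gain_e; setv vBAD (HC 0); setv vCNT (HC 0);
       scan_bad; scan_count;
       PIf (HT (HL (scal vBAD) (HC 0)) (HL (scal vm) (scal vCNT)))
         (setv vFOUND (HC 1)) update_c]) PSkip.

(* The number (n + k + 1)^3 of attempts exceeds [perceptron_bound]. *)
Definition test :=
  pseq [:: setv vFOUND (HC 0); PFor vq vn (PPut aC (scal vq) (HC 0));
           rep 28 vK 3 attempt].

Definition test_writes := [:: 11; 12; 13; 14; 15; 16; 17; 18; 19; 21; 22; 23;
  24; 25; 26; 27; 28; 29; 30; 31; 32; 33]%N.

Section Attempt.
Variables (I : instance) (v0 s0 : 'I_(npts I)) (k : nat).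
Local Notation n := (npts I).
Let a := dist v0 s0 / radius v0.

Definition same (ws : seq nat) (h h' : hst) :=
  forall b j, b \notin ws -> ar h' b j = ar h b j.

Lemma same_run p ws h : all (fun b => b \in ws) (writes p) -> same ws h (run p h).
Proof. by move=> st b j bw; apply: run_frame; apply: notin_sub bw. Qed.

Lemma same_trans ws h1 h2 h3 : same ws h1 h2 -> same ws h2 h3 -> same ws h1 h3.
Proof. by move=> H12 H23 b j bw; rewrite H23 // H12. Qed.

Lemma same_sub ws ws' h h' : all (fun b => b \in ws') ws -> same ws h h' ->
  same ws' h h'.
Proof. by move=> st H b j bw; apply: H; apply: notin_sub bw. Qed.

Lemma same_loaded ws h h' : same ws h h' ->
  all (fun b => b \notin ws) [:: 1; 5; 6; 7; 8]%N -> loaded I h -> loaded I h'.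
Proof. by move=> H /allP st; apply: loaded_eq => b j /st bw; apply: H. Qed.

Lemma same_candidate ws h h' : same ws h h' ->
  all (fun b => b \notin ws) [:: 9; 10]%N -> candidate v0 s0 h -> candidate v0 s0 h'.
Proof. by move=> H /and3P[H1 H2 _] [E1 E2]; split; rewrite H. Qed.

(** The sinks of the assignment in [aBD]: the nodes from [n] on are auxiliary. *)
Definition solution (h : hst) : {set 'I_n} := [set u : 'I_n | n%:Z <= ar h aBD u%:Z].

Definition good h := (#|solution h| <= k)%N /\
  target I <= #|covered (solution h) (9 * a)|%:Z.

Definition witness (S : {set 'I_n}) := (#|S| <= k)%N /\ target I <= #|covered S
  a|%:Z.

Lemma scan_badP h (s : 'I_(n + k) -> 'I_(n + k)) :
  loaded I h -> candidate v0 s0 h -> ar h vN 0 = (n + k)%N%:Z ->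
  ar h vBAD 0 = 0 -> (forall i : 'I_(n + k), ar h aBD i%:Z = (s i)%:Z) ->
  let h' := run scan_bad h in
  (ar h' vBAD 0 = 0 /\ forall i, 0 <= gain a (wt h) i (s i)) \/
  (ar h' vBAD 0 = 1 /\ exists i, gain a (wt h) i (s i) < 0).
Proof.
move=> L cd EN E0 Es /=; rewrite /scan_bad.
pose J i h' := (ar h' vBAD 0 = 0 /\
   forall j : 'I_(n + k), (j < i)%N -> 0 <= gain a (wt h) j (s j)) \/
  (ar h' vBAD 0 = 1 /\ exists i, gain a (wt h) i (s i) < 0).
suff : J (n + k)%N (run scan_bad h).
  by case=> [[E H]|H]; [left; split=> // i; apply: H | right].
apply: run_for => //; first by left; split.
move=> i h1 iN hl fr IH; pose o := Ordinal iN.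
have sm : same [:: vq; vBAD] h h1 by exact: fr.
have L1 := same_loaded sm isT L; have cd1 := same_candidate sm isT cd.
have El : heval (ar h1) (scal vq) = o%:Z by rewrite /= hl.
have Eb : heval (ar h1) (HG aBD (scal vq)) = (s o)%:Z by rewrite /= hl fr // -Es.
rewrite /J run_ifL (gain_eP L1 cd1 El Eb) [heval _ _]/=.
have -> : gain a (wt h1) o (s o) = gain a (wt h) o (s o).
  by rewrite /gain; case: split => // u; rewrite /wt fr.
case: ifP => H; rewrite /setv; step.
  by right; split=> //; exists o; apply: le_lt_trans H _.
case: IH => [[Eb0 H0]|]; [left|by right]; split=> // j; rewrite ltnS leq_eqVlt.
case/orP => [/eqP E|]; last exact: H0.
have -> : j = o by apply: val_inj.
by move: H; lia.
Qed.

Lemma scan_countP h (s : 'I_(n + k) -> 'I_(n + k)) (own : 'I_n -> 'I_n) :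
  loaded I h -> ar h vCNT 0 = 0 ->
  (forall i : 'I_(n + k), ar h aBD i%:Z = (s i)%:Z) ->
  (forall v : 'I_n, ar h aOWN v%:Z = (own v)%:Z) ->
  ar (run scan_count h) vCNT 0 =
    #|[set v | s (lshift k (own v)) != lshift k (own v)]|%:Z.
Proof.
move=> L E0 Es Eo; rewrite /scan_count.
pose J i h' := ar h' vCNT 0 =
  #|[set v : 'I_n | (v < i)%N && (s (lshift k (own v)) != lshift k (own v))]|%:Z.
suff : J n (run scan_count h).
  by rewrite /J => ->; congr _%:Z; apply: eq_card => v; rewrite !inE ltn_ord.
apply: run_for => //; first exact: loaded_n L.
  rewrite /J; step; rewrite E0; symmetry; apply/eqP; rewrite eqz_nat cards_eq0.
  by apply/eqP/setP => v; rewrite !inE.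
move=> i h1 iN hl fr IH; pose o := Ordinal iN.
rewrite /J (card_ltS (fun v => s (lshift k (own v)) != lshift k (own v)) o)
  PoszD -IH.
rewrite run_if /= hl !(fr aBD) // !(fr aOWN) // (Eo o) -[(own o)%:Z]/((lshift k
  (own o) : nat)%:Z) Es subr_eq0 eqz_nat.
rewrite (inj_eq val_inj).
by case: ifP => _; rewrite /setv; step; rewrite ?addr0.
Qed.

Lemma update_cP h : loaded I h -> forall v : 'I_n,
  ar (run update_c h) aC v%:Z = ar h aC v%:Z + (1 - ar h aW v%:Z).
Proof.
move=> L; rewrite /update_c.
pose J i h' := forall v : 'I_n, ar h' aC v%:Z =
  if (v < i)%N then ar h aC v%:Z + (1 - ar h aW v%:Z) else ar h aC v%:Z.
suff H : J n (run update_c h) by move=> v; rewrite H ltn_ord.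
apply: run_for => //; first exact: loaded_n L.
move=> i h1 iN hl fr IH v; step;
  rewrite hl (fr aW) // (IH (Ordinal iN)) ltnn IH [(v < i.+1)%N]ltnS [(v <=
    i)%N]leq_eqVlt eqz_nat.
by case: (eqVneq (nat_of_ord v) i) => [->|].
Qed.

Lemma perceptron_ext m (C : {set 'I_m}) t c c' :
  c =1 c' -> perceptron C t c -> perceptron C t c'.
Proof.
move=> E [H1 H2]; split.
  by rewrite (eq_bigr (fun v => c v ^+ 2)) // => v _; rewrite E.
by rewrite (eq_bigr c) // => v _; rewrite E.
Qed.

Variable h0 : hst.
Hypotheses (L0 : loaded I h0) (cd0 : candidate v0 s0 h0).
Hypotheses (N0 : ar h0 vN 0 = (n + k)%N%:Z) (K0 : ar h0 vK 0 = (n + k).+1%:Z).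
Hypothesis m0 : ar h0 vm 0 = target I.

(** The program knows no witness, so the perceptron bounds are maintained for all of them at
    once. *)
Definition search_inv t h := same test_writes h0 h /\
  ((ar h vFOUND 0 = 1 /\ good h) \/
   (ar h vFOUND 0 = 0 /\ forall S, 0 < target I -> witness S ->
      perceptron (covered S a) t (fun v => ar h aC v%:Z))).

Lemma attempt_step t h : search_inv t h -> search_inv t.+1 (run attempt h).
Proof.
move=> [sm inv]; split.
  apply: same_trans sm _; exact: same_run.
have L := same_loaded sm isT L0; have cd := same_candidate sm isT cd0.
rewrite /attempt /pseq /= run_ifL.
case: inv => [[F1 g]|[F0 inv]]; first by rewrite /= F1 /=; left.
rewrite /= F0 /= !run_seq run_skip.
have [own [W1 W2 W3 W4 W5]] := filter_progP L cd.
set h1 := run filter_prog h in W1 W2 W3 W4 W5 *.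
have sm1 : same filter_writes h h1 by exact: same_run.
have L1 := same_loaded sm1 isT L; have cd1 := same_candidate sm1 isT cd.
have N1 : ar h1 vN 0 = (n + k)%N%:Z by rewrite sm1 // sm.
have K1 : ar h1 vK 0 = (n + k).+1%:Z by rewrite sm1 // sm.
have n_gt0 : (0 < n + k)%N by apply: ltn_addr; apply: leq_ltn_trans (ltn_ord v0).
pose w u : int := #|[set v | own v == u]|%:Z.
have wE h' : same auction_writes h1 h' -> wt h' =1 w by move=> H u;
  rewrite /wt H // W2.
have gE w1 w2 i j : w1 =1 w2 -> gain a w1 i j = gain a w2 i j :> int.
  by move=> E; rewrite /gain; case: split => // u; rewrite E.
have wn u : 0 <= w u <= n%:Z.
  by rewrite /w /= lez_nat -[leqRHS]card_ord max_card.
(* Gains lie between [-n] and [n], so [n] serves as the bound [B], and it is at most the number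
   [n + k] of bidders. *)
have [] := @auctionP gain_e (n + k) (gain a w) n%:Z h1 n_gt0 _ _ N1 K1 _.
- move=> i j; rewrite /gain; case: split => [u|_]; last by rewrite normr0.
  have := wn u; case: split => [v|_]; last by lia.
  by case: ifP => _; [rewrite normr0 | case: ifP => _; lia].
- by rewrite lez_nat leq_addr.
- move=> h' fr' e1 e2 i j E1 E2.
  rewrite (gain_eP (same_loaded fr' isT L1) (same_candidate fr' isT cd1) E1 E2).
  by apply: gE; apply: wE.
set h2 := run (auction gain_e) h1 => s Es opt.
have sm2 : same auction_writes h1 h2 by exact: same_run.
have L2 := same_loaded sm2 isT L1; have cd2 := same_candidate sm2 isT cd1.
have w2 := wE _ sm2.
set h3 := run (setv vBAD _) h2; set h4 := run (setv vCNT _) h3.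
have sm4 : same [:: vBAD; vCNT;
  vq] h2 h4 by exact: (@same_run (PSeq (setv vBAD (HC 0)) (setv vCNT (HC 0)))).
have L4 := same_loaded sm4 isT L2; have cd4 := same_candidate sm4 isT cd2.
have N4 : ar h4 vN 0 = (n + k)%N%:Z by rewrite sm4 // sm2.
have s4 (i : 'I_(n + k)) : ar h4 aBD i%:Z = (s i)%:Z by rewrite sm4 // Es.
have B4 : ar h4 vBAD 0 = 0 by rewrite /h4 /h3 /setv; step.
have sb := scan_badP L4 cd4 N4 B4 s4; set h5 := run scan_bad h4 in sb *.
have sm5 : same [:: vBAD; vq] h4 h5 by exact: same_run.
have L5 := same_loaded sm5 isT L4.
have s5 (i : 'I_(n + k)) : ar h5 aBD i%:Z = (s i)%:Z by rewrite sm5 // s4.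
have C5 : ar h5 vCNT 0 = 0 by rewrite sm5 // /h4 /setv; step.
have o5 (v : 'I_n) : ar h5 aOWN v%:Z = (own v)%:Z by rewrite sm5 // sm4 // sm2.
have sc := scan_countP L5 C5 s5 o5; set h6 := run scan_count h5 in sc *.
have sm6 : same [:: vCNT; vq] h5 h6 by exact: same_run.
have L6 := same_loaded sm6 isT L5.
have g4 i j : gain a (wt h4) i j = gain a w i j :> int.
  by apply: gE => u; rewrite /wt sm4 // -w2.
have m6 : ar h6 vm 0 = target I by rewrite sm6 // sm5 // sm4 // sm2 // sm1 // sm.
have sm36 : same [:: vBAD; vCNT; vq] h2 h6.
  apply: same_trans sm4 _; apply: same_trans (same_sub _ sm5) (same_sub _ sm6) => //.
have B6 : ar h6 vBAD 0 = ar h5 vBAD 0 by rewrite sm6.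
have cond : heval (ar h6) (HT (HL (scal vBAD) (HC 0)) (HL (scal vm) (scal vCNT))) =
    ((ar h5 vBAD 0 <= 0) && (target I <= #|[set v | s (lshift k (own v)) !=
      lshift k (own v)]|%:Z) : nat)%:Z.
  by rewrite -sc -m6 -B6 -and_bool.
rewrite run_if cond bool_neq0; case: ifP => [/andP[Hb Hc]|fail].
  left; rewrite /setv; step; split=> //.
  set h7 := setx _ _ _ _.
  have sol : solution h7 = sinks s.
    by apply/setP => u; rewrite !inE /h7 ar_setx /= sm6 // (s5 (lshift k u)) lez_nat.
  have gs i : 0 <= gain a w i (s i).
    by case: sb => [[_ /(_ i)]|[E _]]; [rewrite g4 | rewrite E in Hb].
  rewrite /good sol card_sinks; split=> //; apply: le_trans Hc _.
  rewrite lez_nat; apply: subset_leq_card; apply/subsetP => v; rewrite inE => mv.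
  exact: (moved_covered (ratio_ge0 v0 s0) gs (W4 v) mv).
right; split.
  rewrite run_frame // sm36 // sm2 // sm1 //.
move=> S mpos wS; have [Sk mS] := wS.
(* Both kinds of failure, a forbidden successor and too few captured points, bound the weight of the
   unknown covered set. *)
have wC : \sum_(u in covered S a) w u < target I.
  have sep u v : 0 < w u -> 0 < w v -> u != v -> ~~ captures a u v || ~~
    captures a v u.
    have ex x : 0 < w x -> exists y, own y = x.
      rewrite /w ltz_nat => /card_gt0P[y]; rewrite inE => /eqP <-; by exists y.
    by move=> /ex Eu /ex Ev; apply: W5.
  case: sb => [[Eb gs]|[Eb [i gi]]].
    apply: (weight_bound (k := k) (s := s) (ratio_ge0 v0 s0) sep Sk mpos opt).
      by move=> i; have := gs i; rewrite g4.
    by move: fail; rewrite Eb /= ltNge => ->.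
  apply: (forbidden_bound (k := k) (s := s) sep Sk mpos opt (i := i)).
  by rewrite -g4.
have wC' := lt_le_trans wC mS.
have C1 v : ar h1 aC v%:Z = ar h aC v%:Z by rewrite sm1.
have Wc v : ar h aC (nat_of_ord v)%:Z <= ar h aC (own v)%:Z by exact: W3.
apply: perceptron_ext (perceptron_step Wc wC' (inv S mpos wS)) => v /=.
by rewrite (update_cP L6) !sm36 // !sm2 // W2 !sm1.
Qed.

Lemma testP :
  let h := run test h0 in
  (ar h vFOUND 0 = 1 /\ good h) \/
  (ar h vFOUND 0 = 0 /\ forall S, 0 < target I -> ~ witness S).
Proof.
rewrite /test /pseq /= !run_seq run_skip.
set h1 := run (setv _ _) h0; set h2 := run (PFor _ _ _) h1.
have sm1 : same test_writes h0 h1 by exact: same_run.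
have sm2 : same test_writes h0 h2 by apply: same_trans sm1 _; exact: same_run.
have L1 := same_loaded sm1 isT L0.
have C2 (v : 'I_n) : 0 = ar h2 aC v%:Z.
  pose J i h' := forall v : 'I_n, (v < i)%N -> 0 = ar h' aC v%:Z.
  suff H : J n h2 by apply: H.
  apply: run_for => //; first exact: loaded_n L1.
  move=> i h' iN hl _ IH {}v; rewrite ltnS leq_eqVlt; step.
  by rewrite hl eqz_nat; case: eqP => //= _ /IH.
have F2 : ar h2 vFOUND 0 = 0 by rewrite run_frame // /h1 /setv; step.
have : search_inv (0 + (n + k).+1 ^ 3) (run (rep 28 vK 3 attempt) h2).
  apply: run_rep.
  - move=> x v h t xr [sm inv]; split.
      move=> b j bw; rewrite ar_setx; case: eqP => [E|_] /=; last exact: sm.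
      by move: bw; rewrite E !inE; move: xr; lia.
    rewrite /good /solution !ar_setx /=.
    have -> : (21 == x)%N = false by lia.
    have sol : [set u : 'I_n | n%:Z <= ar (setx h x 0 v) aBD u%:Z] = solution h.
      by apply/setP => u; rewrite !inE ar_setx; have -> : (17 == x)%N = false by lia.
    rewrite sol; case: inv => [H|[F H]]; [by left | right; split=> // S mp wS].
    apply: perceptron_ext (H S mp wS) => u /=.
    by rewrite ar_setx; have -> : (11 == x)%N = false by lia.
  - exact: attempt_step.
  - by move=> t h [sm _]; rewrite sm.
  - split=> //; right; split=> // S _ _.
    exact: perceptron_ext C2 (perceptron0 _).
case=> _ [H|[F H]]; [by left | right; split=> // S mp wS].
(* A witness would limit the number of failures by the cube of [n], but more attempts than that have
   failed. *)
have := perceptron_bound (H S mp wS); rewrite add0n leqNgt => /negP[].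
by apply: leq_trans (_ : n.+1 ^ 3 <= _)%N;
  rewrite ?ltn_exp2r // leq_exp2r // ltnS leq_addr.
Qed.

End Attempt.

(* vbv, vbs hold the best candidate so far (-1 for none), aSOL its centers. *)
Notation vk := 20%N (only parsing).
Notation vbv := 40%N (only parsing).
Notation vbs := 41%N (only parsing).
Notation aSOL := 42%N (only parsing).
Notation vr := 43%N (only parsing).
Notation vs := 44%N (only parsing).

(** * Reading the instance and searching for the best candidate *)

Definition prelude :=
  pseq [:: PIn vn (HC 0); PIn vk (HC 0); PIn vm (HC 0);
    PIf (HL (scal vk) (scal vn)) PSkip (setv vk (scal vn));
    setv vN (HP (scal vn) (scal vk)); setv vK (HP (scal vN) (HC 1))].

Definition read_radii :=
  PFor vr vn (PSeq (PIn aRN (scal vr)) (PIn aRD (scal vr))).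

Definition read_dists :=
  let i := HP (HT (scal vr) (scal vn)) (scal vs) in
  PFor vr vn (PFor vs vn (PSeq (PIn aDN i) (PIn aDD i))).

Definition ratio_le v1 s1 v2 s2 :=
  HL (HT (HT (dn v1 s1) (HG aRN v2)) (HT (dd v2 s2) (HG aRD v1)))
     (HT (HT (dn v2 s2) (HG aRN v1)) (HT (dd v1 s1) (HG aRD v2))).

Definition record :=
  pseq [:: setv vbv (scal vcv); setv vbs (scal vcs);
    PFor vq vn (PPut aSOL (scal vq) (HL (scal vn) (HG aBD (scal vq))))].

Definition better :=
  HT (scal vFOUND) (not_e (HT (HL (HC 0) (scal vbv))
    (ratio_le (scal vbv) (scal vbs) (scal vcv) (scal vcs)))).

Definition try := pseq [:: test; PIf better record PSkip].

Definition search := pseq [:: setv vbv (HC (-1)); PFor vcv vn (PFor vcs vn try)].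

Definition write_solution :=
  PFor vq vn (PIf (HG aSOL (scal vq)) (POut (scal vq)) PSkip).

Definition main := pseq [:: read_radii; read_dists; search; write_solution].

Lemma prelude_wf : wf [::] prelude. Proof. by []. Qed.

Lemma main_wf : wf [:: vn; vN; vK] main. Proof. by []. Qed.

Lemma run_in a i h : run (PIn a i) h =
  HSt (upd (ar h) a (heval (ar h) i) (head 0 (hin h))) (behead (hin h)) (hout h).
Proof. by []. Qed.

Lemma ar_in f a i x l l' b j :
  ar (HSt (upd f a i x) l l') b j = if (b == a) && (j == i) then x else f b j.
Proof. by []. Qed.

(** The radii alone occupy [2 * n] entries of the tape, each of positive bit length. *)
Lemma npts_input_size (I : instance) : (npts I <= input_size I)%N.
Proof.
rewrite /input_size; apply: (@leq_trans (size (encode I))).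
  rewrite /encode !size_cat.
  have -> s : size (flatten [seq encode_rat (radius v) | v : 'I_(npts I) <- s])
    = (2 * size s)%N.
    by elim: s => //= v s ->; lia.
  by rewrite size_enum_ord; lia.
by rewrite -sum1_size; apply: leq_sum.
Qed.

Definition encode_radii (I : instance) : seq int :=
  flatten [seq encode_rat (radius v) | v <- enum 'I_(npts I)].

Definition encode_dists (I : instance) : seq int :=
  flatten [seq encode_rat (dist u v) | u <- enum 'I_(npts I), v <- enum 'I_(npts I)].

(** The budget is capped at the number of points. No set of points is excluded by this, and the loop
    bounds become linear in the input size, whereas the budget itself is written in binary. *)
Lemma preludeP (I : instance) :
  let h := run prelude (hstart I) in
  [/\ ar h vn 0 = (npts I)%:Z, ar h vm 0 = target I,
      ar h vN 0 = (npts I)%:Z + Num.min (cap I) (npts I)%:Z,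
      ar h vK 0 = (npts I)%:Z + Num.min (cap I) (npts I)%:Z + 1 &
      [/\ hin h = encode_radii I ++ encode_dists I, hout h = [::] &
          forall j, ar h aSOL j = 0]].
Proof.
rewrite /prelude /pseq [foldr _ _ _]/= 3!run_seq.
set h := run (PIn vm _) _.
have E1 : ar h vn 0 = (npts I)%:Z by [].
have E2 : ar h vm 0 = target I by [].
have E3 : ar h vk 0 = cap I by [].
have E4 : hin h = encode_radii I ++ encode_dists I by [].
have E5 : hout h = [::] by [].
have E6 j : ar h aSOL j = 0 by [].
move: h E1 E2 E3 E4 E5 E6 => h E1 E2 E3 E4 E5 E6.
rewrite !run_seq run_skip run_ifL /= E1 E3 minEle.
by case: ifP => _; rewrite ?run_skip /setv !run_put /= !ar_setx /= ?E1 ?E2 ?E3.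
Qed.

Section Main.
Variable I : instance.
Local Notation n := (npts I).

Lemma drop_enum (o : 'I_n) : drop o (enum 'I_n) = o :: drop o.+1 (enum 'I_n).
Proof. by rewrite (drop_nth o) ?size_enum_ord // nth_ord_enum. Qed.

Lemma index_inj (u v u' v' : nat) : (v < n)%N -> (v' < n)%N ->
  (u%:Z * n%:Z + v%:Z == u'%:Z * n%:Z + v'%:Z) = (u == u') && (v == v').
Proof.
move=> vn v'n; rewrite -!PoszM -!PoszD eqz_nat;
  apply/eqP/andP => [E|[/eqP-> /eqP->] //].
have n0 : (0 < n)%N by apply: leq_ltn_trans vn.
have uu : u = u'.
  by have := congr1 (fun x => x %/ n)%N E; rewrite !divnMDl // !divn_small // !addn0.
by move: E; rewrite uu => /addnI ->.
Qed.

Lemma read_radiiP h l : ar h vn 0 = n%:Z ->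
  hin h = encode_radii I ++ l ->
  let h' := run read_radii h in
  [/\ hin h' = l, hout h' = hout h,
      forall v : 'I_n, ar h' aRN v%:Z = numq (radius v) &
      forall v : 'I_n, ar h' aRD v%:Z = denq (radius v)].
Proof.
move=> En Hl /=; rewrite /read_radii; set p := PSeq _ _.
pose J i h' := [/\ hin h' = flatten [seq encode_rat (radius v) | v <- drop i
  (enum 'I_n)] ++ l,
   hout h' = hout h,
   forall v : 'I_n, (v < i)%N -> ar h' aRN v%:Z = numq (radius v) &
   forall v : 'I_n, (v < i)%N -> ar h' aRD v%:Z = denq (radius v)].
suff : J n (run (PFor vr vn p) h).
  by case; rewrite drop_oversize ?size_enum_ord // => H1 H2 H3 H4;
    split=> // v; [apply: H3 | apply: H4].
apply: run_for => //; first by split=> //; rewrite drop0.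
move=> i h1 iN hl fr [H1 H2 H3 H4]; pose o := Ordinal iN.
rewrite /p run_seq !run_in /= ar_in /= hl H1 (drop_enum o) /=.
split=> //= v; rewrite ltnS leq_eqVlt ar_setx /= !ar_in /= ?eqxx /= eqz_nat.
  by case: (eqVneq (nat_of_ord v) i) => [E _|_ /H3 //];
    have -> : v = o by apply: val_inj.
by case: (eqVneq (nat_of_ord v) i) => [E _|_ /H4 //];
  have -> : v = o by apply: val_inj.
Qed.

Lemma read_distsP h l : ar h vn 0 = n%:Z ->
  hin h = encode_dists I ++ l ->
  let h' := run read_dists h in
  [/\ hout h' = hout h,
      forall u v : 'I_n, ar h' aDN (u%:Z * n%:Z + v%:Z) = numq (dist u v) &
      forall u v : 'I_n, ar h' aDD (u%:Z * n%:Z + v%:Z) = denq (dist u v)].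
Proof.
move=> En Hl; rewrite /read_dists; set row := PFor vs vn _.
pose entries (P : nat -> nat -> bool) h' :=
  (forall u v : 'I_n, P u v -> ar h' aDN (u%:Z * n%:Z + v%:Z) = numq (dist u v)) /\
  (forall u v : 'I_n, P u v -> ar h' aDD (u%:Z * n%:Z + v%:Z) = denq (dist u v)).
pose J i h' := [/\ hin h' = flatten [seq encode_rat (dist u v) | u <- drop i
  (enum 'I_n), v <- enum 'I_n] ++ l,
   hout h' = hout h & entries (fun u v => (u < i)%N) h'].
suff : J n (run (PFor vr vn row) h) by case=> _ H2 [H3 H4]; split=> // u v;
  [apply: H3 | apply: H4].
apply: run_for => //; first by split=> //; rewrite drop0.
move=> i h1 iN hl fr [H1 H2 [H3 H4]]; pose o := Ordinal iN.
pose l1 := flatten [seq encode_rat (dist u v) | u <- drop i.+1 (enum 'I_n), v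
  <- enum 'I_n] ++ l.
(* Inner invariant: the rows before [i] are complete, and row [i] is filled up to column [j]. *)
pose J' j h' := [/\ hin h' = flatten [seq encode_rat (dist o v) | v <- drop j
  (enum 'I_n)] ++ l1,
   hout h' = hout h & entries (fun u v => (u < i)%N || (u == i) && (v < j)%N) h'].
have [K1 K2 [K3 K4]] : J' n (run row h1).
  apply: run_for => //; first by rewrite fr.
    split=> //; first by rewrite drop0 -[hin _]/(hin h1) H1 (drop_enum o) /=
      flatten_cat catA.
    by split=> u v; rewrite ltn0 andbF orbF ar_setx /=; [apply: H3 | apply: H4].
  move=> j h2 jN hl2 fr2 [M1 M2 [M3 M4]]; pose p := Ordinal jN.
  have vr2 : ar h2 vr 0 = i%:Z by rewrite fr2.
  have vn2 : ar h2 vn 0 = n%:Z by rewrite fr2 // fr.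
  rewrite run_seq !run_in /= !ar_in /= vr2 vn2 hl2 M1 (drop_enum p) /=.
  have step_entry (u v : 'I_n) : (u < i)%N || (u == i :> nat) && (v < j.+1)%N ->
      (u = o /\ v = p) \/ ((u == i :> nat) && (v == j :> nat) = false /\
         (u < i)%N || (u == i :> nat) && (v < j)%N).
    case: (eqVneq (nat_of_ord u) i) => [Eu|ne] /=.
      rewrite [(v < j.+1)%N]ltnS [(v <= j)%N]leq_eqVlt;
        case: (eqVneq (nat_of_ord v) j) => [Ev _|_ H]; last by right.
      by left; split; apply: val_inj.
    by right.
  split=> //=; split=> u v /step_entry H; rewrite ar_setx /= !ar_in /= index_inj //.
    case: H => [[-> ->]|[-> /M3 //]]; by rewrite /= !eqxx.
  case: H => [[-> ->]|[-> /M4 //]]; by rewrite /= !eqxx.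
split.
- by rewrite -[hin _]/(hin (run row h1)) K1 drop_oversize ?size_enum_ord.
- exact: K2.
split=> u v; rewrite ltnS leq_eqVlt ar_setx /= => /orP H.
  by apply: K3; rewrite ltn_ord andbT orbC; apply/orP.
by apply: K4; rewrite ltn_ord andbT orbC; apply/orP.
Qed.

Definition ratio (v s : 'I_n) : rat := dist v s / radius v.

Lemma ratio_leP h e1 e2 e3 e4 (v1 s1 v2 s2 : 'I_n) : loaded I h ->
  heval (ar h) e1 = v1%:Z -> heval (ar h) e2 = s1%:Z ->
  heval (ar h) e3 = v2%:Z -> heval (ar h) e4 = s2%:Z ->
  heval (ar h) (ratio_le e1 e2 e3 e4) = ((ratio v1 s1 <= ratio v2 s2)%R : nat)%:Z.
Proof.
move=> L /= -> -> -> ->; rewrite !(loaded_n L).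
rewrite !(loaded_RN L) !(loaded_RD L) !(loaded_DN L) !(loaded_DD L);
  congr (nat_of_bool _)%:Z.
rewrite -(ler_int rat) !rmorphM /= !numqE /ratio.
have P q : 0 < (denq q)%:~R :> rat by rewrite ltr0z denq_gt0.
have -> : (dist v1 s1 / radius v1 <= dist v2 s2 / radius v2) =
    (dist v1 s1 * radius v2 <= dist v2 s2 * radius v1).
  by rewrite ler_pdivrMr ?radius_gt0 // mulrAC ler_pdivlMr ?radius_gt0.
have PP := mulr_gt0 (mulr_gt0 (P (dist v1 s1)) (P (dist v2 s2)))
  (mulr_gt0 (P (radius v1)) (P (radius v2))).
rewrite -[RHS](ler_pM2r PP); congr (_ <= _); ring.
Qed.

Definition chosen (h : hst) : {set 'I_n} := [set u : 'I_n | ar h aSOL u%:Z != 0].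

Lemma recordP h (v s : 'I_n) : loaded I h -> candidate v s h ->
  let h' := run record h in
  [/\ ar h' vbv 0 = v%:Z, ar h' vbs 0 = s%:Z & chosen h' = solution I h].
Proof.
move=> L [Ev Es]; rewrite /record /pseq [foldr _ _ _]/= !run_seq run_skip.
set h1 := run (setv vbv _) h; set h2 := run (setv vbs _) h1.
have E1 : ar h2 vbv 0 = v%:Z by rewrite /h2 /h1 /setv; step.
have E2 : ar h2 vbs 0 = s%:Z by rewrite /h2 /h1 /setv; step.
have L2 : loaded I h2.
  have sm : same [:: vbv; vbs] h h2.
    exact: (@same_run (PSeq (setv vbv (scal vcv)) (setv vbs (scal vcs)))).
  exact: same_loaded sm isT L.
split; [by rewrite run_frame | by rewrite run_frame |].
set h3 := run _ h2.
suff H (u : 'I_n) : ar h3 aSOL u%:Z = ((n%:Z <= ar h aBD u%:Z)%R : nat)%:Z.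
  by apply/setP => u; rewrite !inE H bool_neq0.
pose J i h' := forall u : 'I_n, (u < i)%N -> ar h' aSOL u%:Z = ((n%:Z <= ar h
  aBD u%:Z)%R : nat)%:Z.
suff H : J n h3 by apply: H.
apply: run_for => //; first exact: loaded_n L2.
move=> i h' iN hl fr IH {}u; rewrite ltnS leq_eqVlt; step.
rewrite hl eqz_nat; case: eqP => [Eu _|_ /IH //].
rewrite !fr // (loaded_n L2) Eu; congr (nat_of_bool (_ <= _)%R)%:Z.
Qed.

Variables (c : nat) (h0 : hst).
Let k := minn c n.
Hypothesis L0 : loaded I h0.
Hypotheses (N0 : ar h0 vN 0 = (n + k)%N%:Z) (K0 : ar h0 vK 0 = (n + k).+1%:Z).
Hypothesis m0 : ar h0 vm 0 = target I.

(** [P] holds of the candidates tried so far. The recorded ratio is compared only with candidates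
    that have a witness, since a test may also succeed without one. *)
Definition best_inv (P : 'I_n -> 'I_n -> Prop) h :=
  (#|chosen h| <= k)%N /\
  ((ar h vbv 0 = -1 /\ forall v s S, P v s -> 0 < target I -> ~ witness v s k S) \/
   exists v1 s1 : 'I_n, [/\ ar h vbv 0 = v1%:Z, ar h vbs 0 = s1%:Z,
     target I <= #|covered (chosen h) (9 * ratio v1 s1)|%:Z &
     forall v s S, P v s -> 0 < target I -> witness v s k S -> ratio v1 s1 <=
       ratio v s]).

Definition search_writes := [:: 9; 10; 40; 41; 42]%N ++ test_writes.

Lemma best_inv_ext (P P' : 'I_n -> 'I_n -> Prop) h h' :
  (forall v s, P' v s -> P v s) ->
  (forall b j, b \in [:: vbv; vbs; aSOL] -> ar h' b j = ar h b j) ->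
  best_inv P h -> best_inv P' h'.
Proof.
move=> PP E [H1 H2].
have Ec : chosen h' = chosen h by apply/setP => u; rewrite !inE E.
split; first by rewrite Ec.
case: H2 => [[Eb H]|[v1 [s1 [E1 E2 H3 H4]]]]; [left|right].
  by split; [rewrite E | move=> v s S /PP; apply: H].
exists v1, s1; rewrite !E // Ec; split=> // v s S /PP; exact: H4.
Qed.

(** A failed test rules out witnesses for the new candidate. A successful one is recorded unless the
    ratio on record is already at most the new one. *)
Lemma tryP (P P' : 'I_n -> 'I_n -> Prop) h (v s : 'I_n) : same search_writes h0 h ->
  candidate v s h -> best_inv P h ->
  (forall v' s', P' v' s' -> P v' s' \/ (v' = v /\ s' = s)) ->
  best_inv P' (run try h).
Proof.
move=> sm cd inv HP'.
have L := same_loaded sm isT L0.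
rewrite -[run try h]/(run (PIf better record PSkip) (run test h)).
have sm1 : same test_writes h (run test h) by exact: same_run.
have N1 : ar h vN 0 = (n + k)%N%:Z by rewrite sm.
have K1 : ar h vK 0 = (n + k).+1%:Z by rewrite sm.
have m1 : ar h vm 0 = target I by rewrite sm.
have T := testP L cd N1 K1 m1; set h1 := run test h in sm1 T *.
have L1 := same_loaded sm1 isT L; have cd1 := same_candidate sm1 isT cd.
have {inv} inv : best_inv P h1.
  by apply: best_inv_ext inv => // b j; rewrite !inE => /or3P[] /eqP ->; rewrite sm1.
have [Ev Es] := cd1; have [Hk Hb] := inv.
rewrite run_if -[heval _ _]/(ar h1 vFOUND 0 * (1 - (0 <= ar h1 vbv 0)%R%:Z *
  heval (ar h1) (ratio_le (scal vbv) (scal vbs) (scal vcv) (scal vcs)))).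
case: T => [[F [gk gt]]|[F none]]; rewrite F; last first.
  rewrite mul0r eqxx run_skip; split=> //.
  case: Hb => [[Eb H]|[v1 [s1 [E1 E2 H3 H4]]]]; [left|right].
    split=> // v' s' S /HP'[|[-> ->]]; [exact: H | exact: none].
  exists v1, s1; split=> // v' s' S /HP'[|[-> ->]]; first exact: H4.
  by move=> mp /none; case.
have rec : (forall v' s' S, P v' s' -> 0 < target I -> witness v' s' k S ->
  ratio v s <= ratio v' s') ->
    best_inv P' (run record h1).
  move=> H; have [R1 R2 R3] := recordP L1 cd1; split; first by rewrite R3.
  right; exists v, s; rewrite R3; split=> // v' s' S /HP'[|[-> -> //]]; exact: H.
case: Hb => [[Eb H]|[v1 [s1 [E1 E2 H3 H4]]]].
  rewrite Eb mul0r subr0 mul1r /=; apply: rec => v' s' S Pv mp wS.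
  by case: (H _ _ _ Pv mp wS).
rewrite (ratio_leP (v1 := v1) (s1 := s1) (v2 := v) (s2 := s) L1) // E1 /= mul1r
  mul1r not_bool bool_neq0.
case: ifP => [|/negbFE le1].
  rewrite -ltNge => lt1; apply: rec => v' s' S Pv mp wS;
    apply: le_trans (ltW lt1) (H4 _ _ _ Pv mp wS).
rewrite run_skip; split=> //; right; exists v1, s1;
  split=> // v' s' S /HP'[|[-> ->]//].
exact: H4.
Qed.

Lemma searchP : (forall j, ar h0 aSOL j = 0) ->
  best_inv (fun _ _ => True) (run search h0).
Proof.
move=> sol0; rewrite /search /pseq [foldr _ _ _]/= !run_seq run_skip.
set h1 := run (setv _ _) h0; set row := PFor vcs vn try.
have sm1 : same search_writes h0 h1 by exact: same_run.
have L1 := same_loaded sm1 isT L0.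
pose J i h := best_inv (fun v _ => (v < i)%N) h.
suff : J n (run (PFor vcv vn row) h1) by apply: best_inv_ext => // v s _;
  exact: ltn_ord.
apply: run_for => //; first exact: loaded_n L1.
  split.
    suff -> : chosen (setx h1 vcv 0 0) = set0 by rewrite cards0.
    by apply/setP => u; rewrite !inE /h1 /setv; step; rewrite sol0 eqxx.
  by left; split=> //; rewrite /h1 /setv; step.
move=> i h2 iN hl fr inv; pose o := Ordinal iN.
have sm2 : same search_writes h0 h2.
  apply: same_trans sm1 _ => b j bw; apply: fr; apply: notin_sub bw; exact: isT.
have L2 := same_loaded sm2 isT L0.
(* The pairs are tried in lexicographic order. *)
pose J' j h := best_inv (fun v s => (v < i)%N \/ v = o /\ (s < j)%N) h.
have inv' : J' n (run row h2).
  apply: run_for => //; first exact: loaded_n L2.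
    apply: best_inv_ext inv => [v s [//|[_]]//|b j].
    by rewrite !inE => /or3P[] /eqP ->; step.
  move=> j h3 jN hl3 fr3 inv3; pose p := Ordinal jN.
  have sm3 : same search_writes h0 h3.
    apply: same_trans sm2 _ => b z bw; apply: fr3; apply: notin_sub bw; exact: isT.
  have cd3 : candidate o p h3 by split=> //; rewrite fr3.
  apply: (@best_inv_ext (fun v s => (v < i)%N \/ v = o /\ (s < j.+1)%N) _ (run
    try h3)) => //.
    by move=> b z; rewrite !inE => /or3P[] /eqP ->; step.
  apply: tryP sm3 cd3 inv3 _ => v' s' [|[-> sj]]; first by left; left.
  move: sj; rewrite ltnS leq_eqVlt => /orP[/eqP E|sj]; last by left; right.
  by right; split=> //; apply: val_inj.
apply: best_inv_ext inv' => [v s|b j].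
  rewrite ltnS leq_eqVlt => /orP[/eqP E|]; last by left.
  by right; split; [apply: val_inj | exact: ltn_ord].
by rewrite !inE => /or3P[] /eqP ->; step.
Qed.

Lemma write_solutionP h : ar h vn 0 = n%:Z -> hout h = [::] ->
  hout (run write_solution h) = [seq (val v)%:Z | v <- enum 'I_n & v \in chosen h].
Proof.
move=> En Ho; rewrite /write_solution.
pose J i h' := hout h' = [seq (val v)%:Z | v <- take i (enum 'I_n) & v \in chosen h].
suff : J n (run write_solution h) by rewrite /J take_oversize ?size_enum_ord.
apply: run_for => //; first by rewrite /J take0.
move=> i h1 iN hl fr IH; pose o := Ordinal iN.
rewrite /J (take_nth o) ?size_enum_ord // (nth_ord_enum o o) filter_rcons inE
  run_if /= hl fr //.
case: ifP => _; last exact: IH.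
by rewrite map_rcons -IH -[RHS]/(rcons (hout h1) i%:Z) -hl.
Qed.

End Main.

(** * Correctness and running time of the whole program *)

Lemma candidate_exists (I : instance) (S : {set 'I_(npts I)}) opt :
  0 < target I -> achieves S opt ->
  exists v s : 'I_(npts I), ratio v s <= opt /\ target I <= #|covered S (ratio
    v s)|%:Z.
Proof.
move=> mp [_ cov].
pose good (x : 'I_(npts I) * 'I_(npts I)) := ratio x.1 x.2 <= opt.
have goodP (v s : 'I_(npts I)) : dist v s <= opt * radius v -> good (v, s).
  by rewrite /good /ratio /= ler_pdivrMr ?radius_gt0.
have /card_gt0P[v1] : (0 < #|covered S opt|)%N by rewrite -ltz_nat;
  apply: lt_le_trans cov.
rewrite inE => /dist_setP[s1 _ /goodP g1].
(* The largest ratio not exceeding [opt] covers the same points as [opt], since each covered point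
   has its own ratio below it. A positive target provides at least one such ratio. *)
case: (arg_maxP (fun x => ratio x.1 x.2) g1) => -[v s] gvs vs_max.
exists v, s; split=> //; apply: le_trans cov _; rewrite lez_nat.
apply: subset_leq_card; apply/subsetP => u;
  rewrite !inE => /dist_setP[t tS /goodP g].
by apply/dist_setP; exists t => //; rewrite -ler_pdivrMr ?radius_gt0 //;
  apply: (vs_max (u, t)).
Qed.

Lemma main_correct (I : instance) opt : is_optimum I opt ->
  let h := run main (run prelude (hstart I)) in
  exists2 S : {set 'I_(npts I)},
    hout h = [seq (val v)%:Z | v <- enum 'I_(npts I) & v \in S] &
      approx_solution 9 S.
Proof.
move=> [[S0 fS0 _] _].
(* A feasible set exists, so the budget is not negative. *)
have [c Ec] : exists c : nat, cap I = c%:Z.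
  by move: fS0; rewrite /feasible; case: (cap I) => // c _; exists c.
have [] := preludeP I; set h0 := run prelude _ => En Em EN EK [Ei Eo Es].
pose k := minn c (npts I).
have kE : Num.min (cap I) (npts I)%:Z = k%:Z.
  by rewrite Ec /k minEle lez_nat; case: leqP => // /ltnW/minn_idPr ->.
rewrite kE in EN EK.
rewrite /main /pseq [foldr _ _ _]/=; set h := run _ h0.
set h1 := run read_radii h0; set h2 := run read_dists h1; set h3 := run search h2.
have -> : h = run write_solution h3 by [].
have [R1 R2 R3 R4] := read_radiiP En Ei.
have sm1 : same [:: aRN; aRD; vr] h0 h1 by exact: same_run.
have En1 : ar h1 vn 0 = (npts I)%:Z by rewrite sm1.
have R1' : hin h1 = encode_dists I ++ [::] by rewrite cats0.
have [D1 D2 D3] := read_distsP En1 R1'.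
have sm2 : same [:: aDN; aDD; vr; vs] h1 h2 by exact: same_run.
have L2 : loaded I h2 by split=> // [|v|v]; rewrite sm2.
have N2 : ar h2 vN 0 = (npts I + k)%N%:Z by rewrite sm2 // sm1.
have K2 : ar h2 vK 0 = (npts I + k).+1%:Z by rewrite sm2 // sm1 // EK; lia.
have m2 : ar h2 vm 0 = target I by rewrite sm2 // sm1.
have sol2 j : ar h2 aSOL j = 0 by rewrite sm2 // sm1.
have [ck best] := searchP L2 N2 K2 m2 sol2; rewrite -/h3 in ck best.
have sm3 : same search_writes h2 h3 by exact: same_run.
exists (chosen I h3).
  apply: write_solutionP; first by rewrite (loaded_n (same_loaded sm3 isT L2)).
  by have [_ ->] := run_silent h2 (isT : silent search); rewrite -/h2 D1 R2.
split; first by rewrite /feasible Ec lez_nat; apply: leq_trans ck (geq_minl _ _).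
move=> opt' [[S fS aS] _].
have [opt_ge0 cov] := aS.
(* If the target is not positive, any feasible set achieves dilation 0. *)
have [mp|m0] := ltP 0 (target I); last first.
  exists 0; last by rewrite mulr_ge0.
  by split=> //; apply: le_trans m0 _.
have [v [s [rv cov']]] := candidate_exists mp aS.
have wS : witness v s k S.
  have Sn := max_card S; rewrite card_ord in Sn.
  split=> //; rewrite leq_min Sn andbT.
  by move: fS; rewrite /feasible Ec lez_nat.
case: best => [[_ /(_ v s S Logic.I mp wS)]//|[v1 [s1 [_ _ cov1 /(_ v s S
  Logic.I mp wS) le1]]]].
exists (9 * ratio v1 s1).
  split=> //; rewrite mulr_ge0 //; exact: ratio_ge0.
by rewrite ler_pM2l //; apply: le_trans le1 rv.
Qed.

Theorem theorem3p2 : exists A : cmd, polynomial_time A /\ approximates A 9.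
Proof.
(* The constant 2 comes from the largest bound, n + min(k, n) + 1 <= 2n + 1, with n at most the
   input size. *)
have [I x xp|poly outE] := @comp_polynomial [:: vn; vN;
  vK] 2 prelude main prelude_wf main_wf.
  have [En _ EN EK _] := preludeP I.
  have mn : Num.min (cap I) (npts I)%:Z <= (npts I)%:Z by rewrite ge_min lexx orbT.
  have := npts_input_size I.
  by move: xp mn; rewrite !inE => /or3P[] /eqP ->; rewrite ?En ?EN ?EK;
    move: (Num.min _ _) => z; lia.
exists (Seq (comp prelude) (comp main)); split=> // I s t E opt Hopt.
have [S Eo HS] := main_correct Hopt.
exists S => //; exists [seq v <- enum 'I_(npts I) | v \in S];
  first by rewrite (outE _ _ _ E).
by apply/setP => v; rewrite inE mem_filter mem_enum andbT.
Qed.
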